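(* Let $\mu$ be a symmetric probability measure on $\mathbb R$ with unit variance, $L(x)=\log\int e^{xt}\,d\mu(t)$ and $\psi(x)=L(x)/x^2$ (with $\psi(0)=1/2$). Assume that $A:=2\sup_{x\in\mathbb R}\psi(x)<+\infty$, that $A>1$, that the limit $B:=2\lim_{|x|\to+\infty}\psi(x)\ge 0$ exists, and that $x\mapsto L(\sqrt{x})$ is Lipschitz on $[0,+\infty)$. Let $X_N$ be the Wigner matrix associated with $\mu$. Let $\bar I:\mathbb R\to[0,+\infty]$ be infinite on $(-\infty,2)$ and $\bar I(y)=\sup_{\theta\ge0}\{J(y,\theta)-\overline F(\theta)\}$ for $y\ge2$. Then $\bar I$ is lower semicontinuous and grows at infinity like $x^2/(4A)$, i.e. $\bar I(x)\sim\frac{x^2}{4A}$ as $x\to+\infty$. In particular, $\bar I$ is a good rate function (its sublevel sets are compact).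
   Context: Wigner matrix associated with $\mu$: $X_N$ is an $N\times N$ real symmetric random matrix with independent entries $(X_{ij})_{i\le j}$ such that $\sqrt N X_{ij}$ has law $\mu$ for $i<j$ and $\sqrt{N/2}\,X_{ii}$ has law $\mu$ for all $i$. Annealed spherical integral: for $\theta\ge0$, $F_N(\theta)=\frac1N\log\mathbb E_{X_N}\mathbb E_e[\exp(N\theta\langle e,X_Ne\rangle)]$, where $e$ is uniform on $\mathbb S^{N-1}$ and independent of $X_N$; $\overline F(\theta)=\limsup_{N\to+\infty}F_N(\theta)$. Function $J$: let $\sigma(dx)=\frac1{2\pi}\sqrt{4-x^2}\,\mathbf 1_{|x|\le2}dx$ and $G_\sigma(x)=\frac12(x-\sqrt{x^2-4})$. For $x\ge2$ and $\theta\ge0$, $$J(x,\theta)=\theta v-\frac12\int\log(1+2\theta v-2\theta y)\,d\sigma(y),$$ where $v=2\theta$ if $0\le2\theta\le G_\sigma(x)$ and $v=x-\frac1{2\theta}$ if $2\theta>G_\sigma(x)$. *)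

(* Defs.v *)
From mathcomp Require Import all_boot all_order all_algebra.
From mathcomp Require Import all_classical all_reals all_analysis.

Set Implicit Arguments.
Unset Strict Implicit.
Unset Printing Implicit Defensive.
Import Order.TTheory GRing.Theory Num.Theory.
Import numFieldNormedType.Exports.

Local Open Scope classical_set_scope.
Local Open Scope ring_scope.

Definition symmetric_law (R : realType) (mu : probability (measurableTypeR R) R) :=
  forall B : set (measurableTypeR R), measurable B ->
    mu ((fun x => - x) @^-1` B) = mu B.

(* The values are extended reals: [lne +oo = +oo] when exp (x t) is not
   integrable. *)
Definition log_laplace (R : realType) (mu : probability (measurableTypeR R) R)
    (x : R) : \bar R :=
  lne ('M_mu (idfun : measurableTypeR R -> R) x).

Definition psi (R : realType) (mu : probability (measurableTypeR R) R)
    (x : R) : \bar R :=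
  if x == 0 then (2^-1)%:E else (log_laplace mu x * ((x ^+ 2)^-1)%:E)%E.

Definition mutually_independent d (T : measurableType d) (R : realType)
    (P : probability T R) (I : finType) (D : pred I)
    (X : I -> T -> measurableTypeR R) :=
  forall (J : {set I}) (B : I -> set (measurableTypeR R)),
    {subset J <= D} -> (forall i, measurable (B i)) ->
    P (\bigcap_(i in [set` J]) X i @^-1` B i)
      = (\prod_(i in J) P (X i @^-1` B i))%E.

Definition has_law d (T : measurableType d) (R : realType)
    (P : probability T R) (Y : T -> measurableTypeR R)
    (mu : probability (measurableTypeR R) R) :=
  measurable_fun setT Y /\
  forall B : set (measurableTypeR R), measurable B -> P (Y @^-1` B) = mu B.

Definition wigner d (T : measurableType d) (R : realType)
    (P : probability T R) (mu : probability (measurableTypeR R) R)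
    (N : nat) (X : T -> 'M[R]_N) :=
  [/\ forall w, (X w)^T = X w,
      mutually_independent P [pred ij : 'I_N * 'I_N | (ij.1 <= ij.2)%N]
        (fun ij w => X w ij.1 ij.2),
      forall i j : 'I_N, (i < j)%N ->
        has_law P (fun w => Num.sqrt N%:R * X w i j) mu
    & forall i : 'I_N, has_law P (fun w => Num.sqrt (N%:R / 2) * X w i i) mu].

Notation borel_cV R N := (g_sigma_algebraType (@open 'cV[R]_N)).

Definition unit_sphere (R : realType) (N : nat) : set 'cV[R]_N :=
  [set e | \sum_i e i 0 ^+ 2 = 1].

(* The uniform law on the sphere is the rotation-invariant probability carried
   by it. No such law exists for N = 0, the sphere being empty. *)
Definition uniform_on_sphere (R : realType) (N : nat)
    (nu : probability (borel_cV R N) R) :=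
  nu (@unit_sphere R N) = 1%E /\
  forall (Q : 'M[R]_N) (B : set (borel_cV R N)),
    Q^T *m Q = 1%:M -> measurable B ->
    nu ((fun e : 'cV[R]_N => Q *m e) @^-1` B) = nu B.

(* [nu N] is the law of e; since e is independent of X N, the double expectation
   E_X E_e is the iterated integral against the two laws. *)
Section annealed.
Context d (T : measurableType d) (R : realType) (P : probability T R).
Variables (X : forall N, T -> 'M[R]_N).
Variables (nu : forall N, probability (borel_cV R N) R).

Definition quad_form N (M : 'M[R]_N) (e : 'cV[R]_N) : R := (e^T *m M *m e) 0 0.

Definition annealed_F (theta : R) (N : nat) : \bar R :=
  ((N%:R^-1)%:E * lne (\int[P]_w \int[nu N]_e
     (expR (N%:R * theta * quad_form (X N w) e))%:E))%E.

Definition Fbar (theta : R) : \bar R := limn_esup (annealed_F theta).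

End annealed.

(* [vJ] and [J] are only meaningful for 2 <= x and 0 <= theta. *)
Section J.
Context (R : realType).

Definition semicircle_pdf (y : R) : R :=
  if `|y| <= 2 then Num.sqrt (4 - y ^+ 2) / (2 * pi) else 0.

Definition Gsigma (x : R) : R := (x - Num.sqrt (x ^+ 2 - 4)) / 2.

Definition vJ (x theta : R) : R :=
  if 2 * theta <= Gsigma x then 2 * theta else x - (2 * theta)^-1.

Definition J (x theta : R) : R :=
  theta * vJ x theta - 2^-1 *
  \int[lebesgue_measure]_y
     (ln (1 + 2 * theta * vJ x theta - 2 * theta * y) * semicircle_pdf y).

End J.

Definition Ibar d (T : measurableType d) (R : realType) (P : probability T R)
    (X : forall N, T -> 'M[R]_N)
    (nu : forall N, probability (borel_cV R N) R) (y : R) : \bar R :=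
  if y < 2 then +oo%E else
  ereal_sup [set ((J y theta)%:E - Fbar P X nu theta)%E |
             theta in [set theta | 0 <= theta]].

Definition good_rate_function (R : realType) (I : R -> \bar R) :=
  [/\ forall x, (0 <= I x)%E, lower_semicontinuous I
    & forall c : R, compact [set x | (I x <= c%:E)%E]].

(* Main.v *)
(** Write L(x) = ell(x^2); the law being symmetric, independence of the entries
    turns the annealed integral into E_e exp(energy e), where
    energy e = sum_(i <= j) ell(w_ij N theta^2 e_i^2 e_j^2) with w_ij = 4 off the
    diagonal and 2 on it. Since ell(s) <= A s / 2 and the weights sum to
    2 N theta^2 on the sphere, Fbar(theta) <= A theta^2.

    Conversely, for a < A pick s = x^2 with ell(s) >= a s / 2 and let u be the unit
    vector constant on k ~ 2 theta sqrt(N / s) coordinates: the arguments of ell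
    are then close to s, so energy u >= N (a theta^2 - o(1)). As ell is Lipschitz,
    the energy varies by at most O(N theta^2 r) on the cap of radius r around u,
    and a grid covering of the sphere together with rotation invariance shows that
    this cap has mass at least exp(-C_r N). Hence Fbar(theta) >= a' theta^2 - C
    for every a' < A, with C independent of theta.

    Finally J(x, theta) = theta z - 1/2 - 1/2 int log(2 theta (z - y)) d sigma(y)
    for some z that is a 1-Lipschitz function of x; the logarithmic potential is
    1/2-Hoelder on z >= 2 because sigma vanishes like a square root at the edge,
    so J is continuous in x and the supremum is lower semicontinuous. Moreover
    J(x, theta) = theta x up to lower order terms, and optimizing theta x - A theta^2
    gives x^2 / (4 A). *)
Require Import Defs.
From mathcomp Require Import all_boot all_order all_algebra.
From mathcomp Require Import all_classical all_reals all_analysis.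
From mathcomp Require Import measurable_realfun ring lra.
Set Implicit Arguments.
Unset Strict Implicit.
Unset Printing Implicit Defensive.
Import Order.TTheory GRing.Theory Num.Theory.
Import numFieldNormedType.Exports.
Local Open Scope classical_set_scope.
Local Open Scope ring_scope.

(** * Expectation of a product of independent variables *)

Section independence.
Context d (T : measurableType d) (R : realType) (P : probability T R).
Local Open Scope ereal_scope.
Import HBNNSimple.

(** A simple [g] is a finite combination of indicators of its level sets, to each of which the
    hypothesis applies. The choice [h = 1], [c = 1] evaluates the plain integral of [g (Y w)] in the
    same terms. *)
Lemma integral_mul_comp_nnsfun (h : T -> R) (Y : T -> measurableTypeR R)
    (c : \bar R) (g : {nnsfun (measurableTypeR R) >-> R}) :
  measurable_fun setT h -> (forall w, (0 <= h w)%R) -> measurable_fun setT Y ->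
  (forall B, measurable B ->
    \int[P]_w (h w * \1_B (Y w))%:E = c * P (Y @^-1` B)) ->
  \int[P]_w (h w * g (Y w))%:E
    = \sum_(r \in range g) r%:E * (c * P (Y @^-1` (g @^-1` [set r]))).
Proof.
move=> mh h0 mY hB.
have mgr r : measurable (g @^-1` [set r]) by exact: measurable_sfunP.
have mind r : measurable_fun setT (fun w => \1_(g @^-1` [set r]) (Y w) : R).
  by apply: (measurableT_comp _ mY); exact: measurable_indic.
transitivity (\sum_(r \in range g)
   \int[P]_w (r%:E * (h w * \1_(g @^-1` [set r]) (Y w))%:E)).
  rewrite -ge0_integral_fsum//.
  - apply: eq_integral => w _.
    rewrite [in LHS](fimfunE g) EFinM -fsumEFin// ge0_mule_fsumr//.
      by apply: eq_fsbigr => r _; rewrite -!EFinM mulrCA.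
    by move=> r; rewrite nnfun_muleindic_ge0.
  - move=> r; apply/measurable_EFinP/measurable_funM => //.
    exact: measurable_funM.
  - move=> r w _; rewrite -EFinM mulrCA EFinM mule_ge0 ?lee_fin//.
    by have := nnfun_muleindic_ge0 g r (Y w); rewrite lee_fin.
apply: eq_fsbigr => r /[!inE] -[y _ <-].
rewrite ge0_integralZl//.
- by rewrite hB.
- by apply/measurable_EFinP; exact: measurable_funM.
- by move=> w _; rewrite lee_fin mulr_ge0.
- by rewrite lee_fin.
Qed.

(** Monotone convergence lifts the factorization from simple functions to [f]. *)
Lemma integral_mul_comp (h : T -> R) (Y : T -> measurableTypeR R)
    (c : \bar R) (f : measurableTypeR R -> R) :
  measurable_fun setT h -> (forall w, (0 <= h w)%R) -> measurable_fun setT Y ->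
  0 <= c ->
  (forall B, measurable B ->
    \int[P]_w (h w * \1_B (Y w))%:E = c * P (Y @^-1` B)) ->
  measurable_fun setT f -> (forall y, (0 <= f y)%R) ->
  \int[P]_w (h w * f (Y w))%:E = c * \int[P]_w (f (Y w))%:E.
Proof.
move=> mh h0 mY c0 hB mf f0.
have mEf : measurable_fun setT (EFin \o f) by exact/measurable_EFinP.
pose g := nnsfun_approx measurableT mEf.
have gf y : (EFin \o g^~ y) @ \oo --> (f y)%:E.
  by apply: (cvg_nnsfun_approx measurableT mEf) => // x _; rewrite lee_fin.
have ndg y m n : (m <= n)%N -> (g m y <= g n y)%R.
  by move=> mn; exact/lefP/nd_nnsfun_approx.
have mgY n : measurable_fun setT (fun w => g n (Y w)).
  by apply: (measurableT_comp _ mY); exact: measurable_funP.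
have eL n : \int[P]_w (h w * g n (Y w))%:E = c * \int[P]_w (g n (Y w))%:E.
  rewrite (@integral_mul_comp_nnsfun _ _ c)//.
  have := @integral_mul_comp_nnsfun (cst 1%R) Y 1 (g n).
  under eq_integral do rewrite mul1r.
  move=> ->//; last first.
    move=> B mB; under eq_integral do rewrite mul1r.
    rewrite mul1e.
    have -> : (fun w => (\1_B (Y w))%:E) = EFin \o \1_(Y @^-1` B) by [].
    rewrite integral_indic ?setIT// -[X in measurable X]setTI; exact: mY.
  rewrite ge0_mule_fsumr; last first.
    move=> r; rewrite mul1e.
    have [r0|r0] := ltP r 0%R; last by rewrite mule_ge0// lee_fin.
    by rewrite preimage_nnfun0// preimage_set0 measure0 mule0.
  by apply: eq_fsbigr => r _; rewrite mul1e muleCA.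
have cvL : \int[P]_w (h w * g n (Y w))%:E @[n --> \oo]
    --> \int[P]_w (h w * f (Y w))%:E.
  rewrite [X in _ --> X](_ : _ =
      \int[P]_w limn (fun n => (h w * g n (Y w))%:E)); last first.
    apply: eq_integral => w _; apply/esym/cvg_lim => //.
    rewrite EFinM; under eq_fun do rewrite EFinM.
    by apply: cvgeZl => //; exact: gf.
  apply: cvg_monotone_convergence => //.
  - by move=> n; apply/measurable_EFinP; exact: measurable_funM.
  - by move=> n w _; rewrite lee_fin mulr_ge0.
  - by move=> w _ m n mn; rewrite lee_fin ler_wpM2l// ndg.
have cvR : \int[P]_w (g n (Y w))%:E @[n --> \oo] --> \int[P]_w (f (Y w))%:E.
  rewrite [X in _ --> X](_ : _ =
      \int[P]_w limn (fun n => (g n (Y w))%:E)); last first.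
    by apply: eq_integral => w _; apply/esym/cvg_lim => //; exact: gf.
  apply: cvg_monotone_convergence => //.
  - by move=> n; apply/measurable_EFinP.
  - by move=> n w _; rewrite lee_fin.
  - by move=> w _ m n mn; rewrite lee_fin ndg.
have nd : {homo (fun n => \int[P]_w (g n (Y w))%:E) : m n / (m <= n)%N >-> (m <= n)%E}.
  move=> m n mn; apply: ge0_le_integral => //.
  - by move=> w _; rewrite lee_fin.
  - by apply/measurable_EFinP; exact: mgY.
  - by apply/measurable_EFinP; exact: mgY.
  - by move=> w _; rewrite lee_fin ndg.
have cvR' : (c * \int[P]_w (g n (Y w))%:E) @[n --> \oo]
    --> c * \int[P]_w (f (Y w))%:E.
  (* Multiplication by a finite [c] is continuous. For [c = +oo] the products are eventually [+oo]
     if some integral is positive, and all zero otherwise. *)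
  move: c0 {hB eL}; case: c => [c|_|//] c0; first by apply: cvgeZl => //; exact: cvR.
  rewrite (_ : \int[P]_w (f (Y w))%:E =
    ereal_sup (range (fun n => \int[P]_w (g n (Y w))%:E))); last first.
    apply: (cvg_unique _ cvR) => //.
    exact: ereal_nondecreasing_cvgn.
  set u := fun n => \int[P]_w (g n (Y w))%:E.
  have u0 n : 0 <= u n by apply: integral_ge0 => w _; rewrite lee_fin.
  have [[n un]|un0] := pselect (exists n, 0 < u n).
    apply: cvg_near_cst; near=> m.
    rewrite !gt0_mulye//.
      by apply: (lt_le_trans un); apply: ereal_sup_ubound; exists n.
    by apply: (lt_le_trans un); apply: nd; near: m; exists n.
  have uE : u = cst 0.
    apply/funext => n; apply/eqP; rewrite eq_le u0 andbT leNgt.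
    by apply/negP => ?; apply: un0; exists n.
  rewrite (_ : range u = [set 0]); last first.
    by rewrite uE; apply/seteqP; split => [_ [n _ <-]//|_ ->]; exists 0%N.
  rewrite ereal_sup1 mule0; apply: cvg_near_cst; near=> m.
  by rewrite -/(u m) uE /= mule0.
apply: (cvg_unique _ cvL) => //.
have -> : (fun n => \int[P]_w (h w * g n (Y w))%:E) =
  (fun n => c * \int[P]_w (g n (Y w))%:E) by apply/funext.
exact: cvR'.
Unshelve. all: by end_near. Qed.

(* The indicators indexed by K are what an induction on s can trade, one index at
   a time, for the general factors f i. *)
Lemma expectation_prod_indep (I : finType) (D : pred I)
    (X : I -> T -> measurableTypeR R) (f : I -> measurableTypeR R -> R)
    (s : seq I) (K : {set I}) (B : I -> set (measurableTypeR R)) :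
  mutually_independent P D X -> (forall i, D i -> measurable_fun setT (X i)) ->
  (forall i, measurable_fun setT (f i)) -> (forall i y, (0 <= f i y)%R) ->
  (forall i, measurable (B i)) ->
  uniq s -> {subset s <= D} -> {subset K <= D} -> {in s, forall i, i \notin K} ->
  \int[P]_w ((\prod_(i <- s) f i (X i w)) *
      \1_(\bigcap_(i in [set` K]) X i @^-1` B i) w)%:E
   = (\prod_(i <- s) \int[P]_w (f i (X i w))%:E)
     * P (\bigcap_(i in [set` K]) X i @^-1` B i).
Proof.
move=> indX mX mf f0.
have mI (K' : {set I}) B' : {subset K' <= D} -> (forall i, measurable (B' i)) ->
    measurable (\bigcap_(i in [set` K']) X i @^-1` B' i).
  move=> KD mB'; apply: fin_bigcap_measurable => [|i /= iK].
    exact: finite_finset.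
  by rewrite -[X in measurable X]setTI; apply: mX => //; exact: KD.
elim: s K B => [|j s IH] K B mB.
  move=> _ _ KD _; rewrite big_nil mul1e.
  under eq_integral do rewrite big_nil mul1r.
  by rewrite integral_indic ?setIT//; exact: mI.
move=> /= /andP[js us] sD KD sK.
have jD : D j by apply: sD; rewrite mem_head.
have sD' : {subset s <= D} by move=> i si; apply: sD; rewrite inE si orbT.
have mprod : measurable_fun setT (fun w => \prod_(i <- s) f i (X i w))%R.
  apply: measurable_prod => i si; apply: measurableT_comp => //.
  exact/mX/sD'.
have p0 : 0 <= \prod_(i <- s) \int[P]_w (f i (X i w))%:E.
  by apply: prode_ge0 => i _; apply: integral_ge0 => w _; rewrite lee_fin.
pose h w := ((\prod_(i <- s) f i (X i w)) *
      \1_(\bigcap_(i in [set` K]) X i @^-1` B i) w)%R.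
transitivity (\int[P]_w (h w * f j (X j w))%:E).
  by apply: eq_integral => w _; rewrite big_cons /h -mulrA mulrC.
rewrite (@integral_mul_comp h (X j) (\prod_(i <- s) \int[P]_w (f i (X i w))%:E
     * P (\bigcap_(i in [set` K]) X i @^-1` B i)) (f j)) //.
- by rewrite big_cons muleC muleA.
- by apply: measurable_funM => //; apply: measurable_indic; exact: mI.
- by move=> w; rewrite mulr_ge0// prodr_ge0.
- exact: mX.
- by rewrite mule_ge0.
move=> B' mB'.
have jK : j \notin K by apply: sK; rewrite mem_head.
(* The event that [X j] lies in [B'] joins the intersection as a new index [j] of [K], so that the
   induction hypothesis covers the remaining factors. *)
pose B2 i := if i == j then B' else B i.
have mB2 i : measurable (B2 i) by rewrite /B2; case: ifP.
have K2D : {subset j |: K <= D}.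
  by move=> i; rewrite in_setU1 => /predU1P[->//|/KD].
have cap : \bigcap_(i in [set` K]) X i @^-1` B i
    = \bigcap_(i in [set` K]) X i @^-1` B2 i.
  apply: eq_bigcapr => i /= iK; rewrite /B2; case: eqP => // ij.
  by rewrite -ij iK in jK.
have capj : \bigcap_(i in [set` (j |: K)%SET]) X i @^-1` B2 i
   = (X j @^-1` B') `&` \bigcap_(i in [set` K]) X i @^-1` B i.
  rewrite cap; apply/seteqP; split => [w H|w [H1 H2] i /=].
    split; last by move=> i /= iK; apply: H; rewrite /= in_setU1 iK orbT.
    by have := H j; rewrite /= in_setU1 eqxx /B2 eqxx; exact.
  by rewrite in_setU1 => /predU1P[->|/H2//]; rewrite /B2 eqxx.
transitivity (\int[P]_w ((\prod_(i <- s) f i (X i w)) *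
      \1_(\bigcap_(i in [set` (j |: K)%SET]) X i @^-1` B2 i) w)%:E).
  apply: eq_integral => w _; rewrite capj indicI /h /= -mulrA; congr (_ * _)%:E.
  by rewrite mulrC.
rewrite IH//; last first.
  move=> i si; rewrite in_setU1 negb_or sK ?inE ?si ?orbT// andbT.
  by apply: contraNneq js => <-.
rewrite -muleA; congr (_ * _).
rewrite indX// big_setU1//= {1}/B2 eqxx cap indX// muleC; congr (_ * _).
Qed.

End independence.

(** * Laplace transform and the annealed energy *)

Section law.
Context d (T : measurableType d) (R : realType) (P : probability T R).
Variable mu : probability (measurableTypeR R) R.
Local Open Scope ereal_scope.

Lemma integral_has_law (Y : T -> measurableTypeR R)
    (f : measurableTypeR R -> \bar R) :
  has_law P Y mu -> measurable_fun setT f -> (forall y, 0 <= f y) ->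
  \int[P]_w f (Y w) = \int[mu]_y f y.
Proof.
move=> [mY YE] mf f0; rewrite -(@eq_measure_integral _ _ _ setT mu (pushforward P Y)).
  by rewrite ge0_integral_pushforward.
by move=> B mB _; exact: YE.
Qed.

End law.

Section laplace.
Context (R : realType) (mu : probability (measurableTypeR R) R).
Hypothesis mu_sym : symmetric_law mu.

(** The function [L (sqrt s)]. Finiteness of [A] makes [log_laplace] finite, so [fine] loses
    nothing, and by symmetry [L x = ell (x ^+ 2)] for both signs of [x]. *)
Definition ell (s : R) : R := fine (log_laplace mu (Num.sqrt s)).

Let idR := idfun : measurableTypeR R -> R.

Let mexp (x : R) : measurable_fun setT
  (fun t : measurableTypeR R => (expR (x * t))%:E : \bar R).
Proof.
by apply/measurable_EFinP; apply: measurableT_comp => //.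
Qed.

Lemma mgfE x : 'M_mu idR x = (\int[mu]_t (expR (x * t))%:E)%E.
Proof.
by rewrite /mmt_gen_fun unlock; apply: eq_integral => t _ /=; rewrite mulrC.
Qed.

Lemma mgfN x : 'M_mu idR (- x) = 'M_mu idR x.
Proof.
rewrite !mgfE.
have mN : measurable_fun setT (fun t : measurableTypeR R => - t : measurableTypeR R).
  exact: measurable_funN.
rewrite -[RHS](@integral_has_law _ _ _ mu mu (fun t => - t) (fun t => (expR (x * t))%:E)) //.
by apply: eq_integral => t _; rewrite mulrN mulNr.
Qed.

(** By symmetry twice the transform is the integral of [exp (x t) + exp (- x t)], which is at least
    2 pointwise. *)
Lemma mgf_ge1 x : (1 <= 'M_mu idR x)%E.
Proof.
have : ((2 : R)%:E <= 'M_mu idR x + 'M_mu idR x)%E.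
  rewrite -[X in (_ <= X + _)%E]mgfN !mgfE -ge0_integralD//.
  have <- : (\int[mu]_t (cst (2 : R)%:E t))%E = (2 : R)%:E.
    rewrite integral_cst// -[RHS]mule1; congr (_ * _)%E.
    exact: probability_setT.
  apply: ge0_le_integral => //.
  - by move=> t _; rewrite /cst lee_fin.
  - exact: emeasurable_funD.
  move=> t _; rewrite /cst -EFinD lee_fin.
  have := expR_ge1Dx (- x * t); have := expR_ge1Dx (x * t).
  by rewrite mulNr => h1 h2; lra.
case: ('M_mu idR x) => [r| |]//=; rewrite ?leey// -EFinD !lee_fin => h; lra.
Qed.

Lemma log_laplaceN x : log_laplace mu (- x) = log_laplace mu x.
Proof. by rewrite /log_laplace mgfN. Qed.

Lemma log_laplace_ge0 x : (0 <= log_laplace mu x)%E.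
Proof. by rewrite /log_laplace lne_ge0 mgf_ge1. Qed.

Lemma log_laplace0 : log_laplace mu 0 = 0%E.
Proof.
rewrite /log_laplace mgfE; under eq_integral do rewrite mul0r expR0.
rewrite integral_cst// mul1e -lne1; congr lne.
exact: probability_setT.
Qed.

Variable A : R.
Hypothesis A_sup : A%:E = (2%:E * ereal_sup (range (psi mu)))%E.

Let sup_psi : ereal_sup (range (psi mu)) = (A / 2)%:E.
Proof.
case: (ereal_sup _) A_sup => [r| |].
- by rewrite -EFinM => -[->]; rewrite mulrAC divff// mul1r.
- by rewrite gt0_muley// lte_fin.
- by rewrite gt0_muleNy// lte_fin.
Qed.

Lemma log_laplace_le x : (log_laplace mu x <= (A / 2 * x ^+ 2)%:E)%E.
Proof.
have [->|x0] := eqVneq x 0; first by rewrite log_laplace0 expr0n mulr0.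
have : (psi mu x <= (A / 2)%:E)%E by rewrite -sup_psi; apply: ereal_sup_ubound; exists x.
by rewrite /psi (negbTE x0) lee_pdivrMr// exprn_even_gt0.
Qed.

Lemma log_laplaceE x : log_laplace mu x = (ell (x ^+ 2))%:E.
Proof.
have fin y : log_laplace mu y \is a fin_num.
  rewrite ge0_fin_numE ?log_laplace_ge0//.
  by rewrite (le_lt_trans (log_laplace_le y))// ltry.
rewrite /ell fineK// sqrtr_sqr; case: (ger0P x) => // _.
by rewrite log_laplaceN.
Qed.

Lemma mgf_ell x : ('M_mu idR x = (expR (ell (x ^+ 2)))%:E)%E.
Proof.
have := log_laplaceE x; rewrite /log_laplace => h.
have : expeR (lne ('M_mu idR x)) = 'M_mu idR x.
  by apply/eqP; rewrite lneK_eq (le_trans _ (mgf_ge1 x)).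
by rewrite h.
Qed.

Lemma ell_ge0 s : 0 <= s -> 0 <= ell s.
Proof.
by move=> s0; rewrite -(sqr_sqrtr s0) -lee_fin -log_laplaceE log_laplace_ge0.
Qed.

Lemma ell_le s : 0 <= s -> ell s <= A / 2 * s.
Proof.
by move=> s0; rewrite -[in leLHS](sqr_sqrtr s0) -lee_fin -log_laplaceE
  (le_trans (log_laplace_le _))// sqr_sqrtr.
Qed.

(** The hypothesis [1 < a] excludes the witness [x = 0], where [psi] is 1/2, so that [s = x ^+ 2] is
    positive. *)
Lemma ell_near_sup a : 1 < a -> a < A -> exists2 s, 0 < s & a / 2 * s <= ell s.
Proof.
move=> a1 aA.
have : ((a / 2)%:E < ereal_sup (range (psi mu)))%E.
  by rewrite sup_psi lte_fin; lra.
move=> /ereal_sup_gt[_ [x _ <-]]; rewrite /psi; case: eqVneq => [_|x0].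
  by rewrite lte_fin => h; exfalso; lra.
move=> h; exists (x ^+ 2); first by rewrite exprn_even_gt0.
move: h; rewrite lte_pdivlMr ?exprn_even_gt0// log_laplaceE -EFinM lte_fin.
exact: ltW.
Qed.

End laplace.

(** The pairs below the diagonal are swapped onto those above it, which therefore count twice. *)
Lemma sum_sym_pairs (R : comPzRingType) N (a : 'I_N -> 'I_N -> R) :
  (forall i j, a i j = a j i) ->
  \sum_i \sum_j a i j = \sum_(p : 'I_N * 'I_N | (p.1 <= p.2)%N)
    (if p.1 == p.2 then 1 else 2) * a p.1 p.2.
Proof.
move=> aC; rewrite pair_bigA/= (bigID (fun p : 'I_N * 'I_N => (p.1 <= p.2)%N))/=.
rewrite [in X in _ + X](reindex_inj (h := fun p => (p.2, p.1)))/=; last first.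
  by move=> [? ?] [? ?] [-> ->].
under [in X in _ + X]eq_bigl do rewrite -ltnNge.
under [in X in _ + X]eq_bigl => p do rewrite ltn_neqAle andbC.
rewrite [X in _ + X]big_mkcondr -big_split/=; apply: eq_bigr => p _.
rewrite (aC p.2) -val_eqE; case: eqVneq => _ /=; first by rewrite addr0 mul1r.
by rewrite mulr2n mulrDl mul1r.
Qed.

(** * Expectation over the Wigner matrix *)

Section wigner_mgf.
Context (R : realType) (mu : probability (measurableTypeR R) R).
Hypothesis mu_sym : symmetric_law mu.
Variable A : R.
Hypothesis A_sup : A%:E = (2%:E * ereal_sup (range (psi mu)))%E.

(** An off-diagonal entry occurs twice in the quadratic form, with squared scale [1 / N]; a diagonal
    one occurs once, with squared scale [2 / N]. This gives 4 and 2. *)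
Definition pair_weight N (p : 'I_N * 'I_N) : R := if p.1 == p.2 then 2 else 4.

Definition energy N (theta : R) (e : 'cV[R]_N) : R :=
  \sum_(p : 'I_N * 'I_N | (p.1 <= p.2)%N)
    ell mu (pair_weight p * (N%:R * theta ^+ 2) * (e p.1 0 ^+ 2 * e p.2 0 ^+ 2)).

Lemma quad_formE N (M : 'M[R]_N) (e : 'cV[R]_N) :
  quad_form M e = \sum_i \sum_j e i 0 * M i j * e j 0.
Proof.
rewrite /quad_form mxE; under eq_bigr do rewrite mxE mulr_suml.
by rewrite exchange_big /=; apply: eq_bigr => i _; apply: eq_bigr => j _; rewrite mxE.
Qed.

Context d (T : measurableType d) (P : probability T R).

Lemma measurable_scaled (c : R) (Y : T -> R) : c != 0 ->
  measurable_fun setT (fun w => c * Y w) -> measurable_fun setT Y.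
Proof.
move=> c0 h; rewrite (_ : Y = (fun w => c^-1 * (c * Y w))); last first.
  by apply/funext => w; rewrite mulKf.
exact: measurable_funM.
Qed.

Lemma wigner_measurable N (X : T -> 'M[R]_N) i j : (0 < N)%N ->
  wigner P mu X -> measurable_fun setT (fun w => X w i j).
Proof.
move=> N0 [Xsym _ off diag].
have off' (i' j' : 'I_N) : (i' < j')%N -> measurable_fun setT (fun w => X w i' j').
  move=> ij; apply: (@measurable_scaled (Num.sqrt N%:R)) => //.
    by rewrite sqrtr_eq0 -ltNge ltr0n.
  by case: (off _ _ ij).
case: (ltngtP i j) => [|ji|/val_inj<-]; first exact: off'.
  rewrite (_ : (fun _ => _) = (fun w => X w j i)); first exact: off'.
  by apply/funext => w; rewrite -[in LHS](Xsym w) mxE.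
apply: (@measurable_scaled (Num.sqrt (N%:R / 2))) => //.
  by rewrite sqrtr_eq0 -ltNge divr_gt0// ltr0n.
by case: (diag i).
Qed.

Lemma expectation_exp_law (Y : T -> measurableTypeR R) (c a : R) : 0 < c ->
  has_law P (fun w => Num.sqrt c * Y w) mu ->
  (\int[P]_w (expR (a * Y w))%:E = (expR (ell mu (a ^+ 2 / c)))%:E)%E.
Proof.
move=> c0 lawY; have sc0 : Num.sqrt c != 0 by rewrite sqrtr_eq0 -ltNge.
have -> : a ^+ 2 / c = (a / Num.sqrt c) ^+ 2.
  by rewrite expr_div_n sqr_sqrtr// ltW.
rewrite -(mgf_ell mu_sym A_sup) mgfE -(integral_has_law lawY).
- by apply: eq_integral => w _; rewrite mulrA mulfVK.
- by apply/measurable_EFinP; apply: measurableT_comp.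
- by move=> t; rewrite lee_fin expR_ge0.
Qed.

Lemma wigner_mgf N (X : T -> 'M[R]_N) (theta : R) (e : 'cV[R]_N) : (0 < N)%N ->
  wigner P mu X ->
  (\int[P]_w (expR (N%:R * theta * quad_form (X w) e))%:E
    = (expR (energy theta e))%:E)%E.
Proof.
move=> N0 wX; have [Xsym indX off diag] := wX.
pose D := [pred ij : 'I_N * 'I_N | (ij.1 <= ij.2)%N].
pose c (p : 'I_N * 'I_N) : R :=
  N%:R * theta * ((if p.1 == p.2 then 1 else 2) * (e p.1 0 * e p.2 0)).
pose f p (x : measurableTypeR R) := expR (c p * x).
pose s := [seq p <- index_enum _ | D p].
have qE w : expR (N%:R * theta * quad_form (X w) e)
    = \prod_(p <- s) f p (X w p.1 p.2).
  rewrite quad_formE sum_sym_pairs; last first.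
    by move=> i j; rewrite -[in LHS](Xsym w) mxE; ring.
  rewrite mulr_sumr expR_sum big_filter; apply: eq_bigr => p _.
  by rewrite /f /c; congr expR; case: ifP => _; ring.
(* With [K] empty, the indicator and the probability of the intersection are both 1. *)
have := @expectation_prod_indep _ T R P _ D (fun ij w => X w ij.1 ij.2) f s
  finset.set0 (fun=> setT) indX.
under eq_integral do rewrite -qE.
rewrite (_ : \bigcap_(i in _) _ = setT); last first.
  by apply/seteqP; split => // w _ i /=; rewrite finset.in_set0.
under eq_integral do rewrite indicT mulr1.
rewrite probability_setT mule1 => ->.
- rewrite big_filter /energy expR_sum -prodEFin; apply: eq_bigr => p Dp.
  rewrite /f /pair_weight; case: eqVneq => [p12|p12].
    rewrite (@expectation_exp_law _ (N%:R / 2)); last 2 first.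
    - by rewrite divr_gt0// ltr0n.
    - by rewrite p12; exact: diag.
    congr (expR (ell mu _))%:E; rewrite /c p12 eqxx.
    by field; rewrite pnatr_eq0 -lt0n.
  rewrite (@expectation_exp_law _ N%:R); last 2 first.
  - by rewrite ltr0n.
  - by apply: off; rewrite ltn_neqAle (inj_eq val_inj) p12; exact: Dp.
  congr (expR (ell mu _))%:E; rewrite /c (negbTE p12).
  by field; rewrite pnatr_eq0 -lt0n.
- by move=> p _; exact: wigner_measurable.
- by move=> p; apply: measurableT_comp => //; exact: measurable_funM.
- by move=> p y; exact: expR_ge0.
- by [].
- by rewrite filter_uniq// index_enum_uniq.
- by move=> p; rewrite mem_filter => /andP[].
- by move=> p; rewrite finset.in_set0.
- by move=> p _; rewrite finset.in_set0.
Qed.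

(** After [ell s <= A / 2 * s], the sum over ordered pairs unfolds to a full double sum, the square
    of the sum of the [e i 0 ^+ 2], hence 1. *)
Lemma energy_le N (theta : R) (e : 'cV[R]_N) : \sum_i e i 0 ^+ 2 = 1 ->
  energy theta e <= A * N%:R * theta ^+ 2.
Proof.
move=> e1.
have -> : A * N%:R * theta ^+ 2 = \sum_(p : 'I_N * 'I_N | (p.1 <= p.2)%N)
    A / 2 * (pair_weight p * (N%:R * theta ^+ 2) * (e p.1 0 ^+ 2 * e p.2 0 ^+ 2)).
  transitivity (\sum_i \sum_j (A * N%:R * theta ^+ 2 * (e i 0 ^+ 2 * e j 0 ^+ 2))).
    under eq_bigr do rewrite -mulr_sumr -mulr_sumr e1 mulr1.
    by rewrite -mulr_sumr e1 mulr1.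
  rewrite sum_sym_pairs; last by move=> i j; congr (_ * _); rewrite mulrC.
  by apply: eq_bigr => p _; rewrite /pair_weight; case: ifP => _; field.
apply: ler_sum => p _; apply: (ell_le mu_sym A_sup).
apply: mulr_ge0; last by rewrite mulr_ge0 ?sqr_ge0.
apply: mulr_ge0; first by rewrite /pair_weight; case: ifP.
by rewrite mulr_ge0 ?sqr_ge0.
Qed.

End wigner_mgf.

(** * Mass of spherical caps *)

Section sphere.
Context (R : realType) (N : nat).
Implicit Types (e u v : 'cV[R]_N) (r : R).

Lemma measurable_coord i :
  measurable_fun setT (fun e : borel_cV R N => e i 0 : measurableTypeR R).
Proof.
move=> _; apply: (measurability _ (RGenOpens.measurableE R)) => //.
move=> _ [_ [a [b ->] <-]]; rewrite setTI; apply: sub_sigma_algebra.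
move/continuousP : (@coord_continuous R N 1 i 0); apply.
exact: interval_open.
Qed.

Definition sqnorm e : R := \sum_i e i 0 ^+ 2.

(** A closed Euclidean ball of the whole space; a law carried by the sphere only sees its trace
    there. *)
Definition cap u r : set (borel_cV R N) := [set e | sqnorm (e - u) <= r ^+ 2].

Lemma measurable_sqnorm_sub u :
  measurable_fun setT (fun e : borel_cV R N => sqnorm (e - u) : measurableTypeR R).
Proof.
apply: measurable_sum => i; apply: measurable_funX.
rewrite (_ : (fun _ => _) = (fun e : borel_cV R N => e i 0 - u i 0)).
  by apply: measurable_funB => //; exact: measurable_coord.
by apply/funext => e; rewrite !mxE.
Qed.

Lemma measurable_cap u r : measurable (cap u r).
Proof.
rewrite (_ : cap u r = setT `&` (fun e => sqnorm (e - u)) @^-1` `]-oo, r ^+ 2]).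
  exact: measurable_sqnorm_sub.
by rewrite setTI; apply/seteqP; split => e; rewrite /= in_itv.
Qed.

Lemma measurable_unit_sphere : measurable (@unit_sphere R N : set (borel_cV R N)).
Proof.
rewrite (_ : @unit_sphere R N = setT `&` (fun e => sqnorm (e - 0)) @^-1` [set 1]).
  exact: measurable_sqnorm_sub.
by rewrite setTI; apply/seteqP; split => e /=; rewrite subr0.
Qed.

Lemma sqnormE e : e^T *m e = (sqnorm e)%:M.
Proof.
by apply/matrixP => i j; rewrite !ord1 !mxE eqxx mulr1n; apply: eq_bigr => k _; rewrite mxE.
Qed.

Lemma sqnorm_orthogonal (Q : 'M[R]_N) e : Q^T *m Q = 1%:M ->
  sqnorm (Q *m e) = sqnorm e.
Proof.
move=> QQ; have : (Q *m e)^T *m (Q *m e) = e^T *m e.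
  by rewrite trmx_mul -mulmxA (mulmxA Q^T) QQ mul1mx.
by rewrite !sqnormE => /matrixP/(_ 0 0); rewrite !mxE eqxx !mulr1n.
Qed.

(* Householder reflection along [u - v]. *)
Lemma orthogonal_transitive u v : sqnorm u = 1 -> sqnorm v = 1 ->
  exists2 Q : 'M[R]_N, Q^T *m Q = 1%:M & Q *m u = v.
Proof.
move=> u1 v1; have [->|uv] := eqVneq u v.
  by exists 1%:M; rewrite ?trmx1 ?mul1mx.
pose w := u - v; pose n := sqnorm w.
have n0 : n != 0.
  apply: contra uv; rewrite /n psumr_eq0 => [/allP h|i _]; last exact: sqr_ge0.
  rewrite -subr_eq0; apply/eqP/matrixP => i j; rewrite ord1 [in RHS]mxE.
  by have := h i (mem_index_enum _); rewrite sqrf_eq0 => /eqP.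
pose a := (v^T *m u) 0 0.
have vu : v^T *m u = a%:M.
  by apply/matrixP => i j; rewrite !ord1 [in RHS]mxE eqxx mulr1n.
have uv' : u^T *m v = a%:M by rewrite -[LHS]trmxK trmx_mul trmxK vu tr_scalar_mx.
have wT : w^T = u^T - v^T by rewrite /w linearB.
have nE : n = 2 - 2 * a.
  have : w^T *m w = n%:M by rewrite sqnormE.
  rewrite wT /w mulmxBl !mulmxBr !sqnormE vu uv' u1 v1.
  by move=> /matrixP/(_ 0 0); rewrite !mxE eqxx !mulr1n => <-; ring.
(* Equal norms make the component of [u] along [w] exactly half of [w], so the reflection subtracts
   [w] from [u]. *)
have wu : w^T *m u = (n / 2)%:M.
  rewrite wT mulmxBl sqnormE vu u1 nE -raddfB /=; congr (_%:M).
  by field.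
pose Q := 1%:M - (2 / n) *: (w *m w^T).
have QT : Q^T = Q by rewrite /Q linearB /= linearZ /= trmx_mul trmxK trmx1.
exists Q.
  set Z := (2 / n) *: (w *m w^T).
  have ZZ : Z *m Z = Z + Z.
    rewrite -scalemxAl -scalemxAr scalerA -mulmxA (mulmxA w^T) sqnormE -/n.
    rewrite mul_scalar_mx -scalemxAr scalerA -scalerDl; congr (_ *: _).
    by field.
  rewrite QT /Q -/Z mulmxBl !mulmxBr !mul1mx mulmx1 ZZ.
  by rewrite opprB addrK subrK.
rewrite /Q mulmxBl mul1mx -scalemxAl -mulmxA wu mul_mx_scalar scalerA.
have -> : 2 / n * (n / 2) = 1 by field.
by rewrite scale1r /w opprB addrC subrK.
Qed.

Variable nu : probability (borel_cV R N) R.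
Hypothesis nu_unif : uniform_on_sphere nu.

(** An orthogonal map sending [u] to [v] pulls the cap around [v] back to the cap around [u]. *)
Lemma cap_measure_eq u v r : sqnorm u = 1 -> sqnorm v = 1 ->
  nu (cap u r) = nu (cap v r).
Proof.
move=> u1 v1; have [Q QQ Quv] := orthogonal_transitive u1 v1.
rewrite -(nu_unif.2 Q (cap v r) QQ (measurable_cap v r)); congr (nu _).
by apply/seteqP; split => e; rewrite /cap /= -Quv -mulmxBr sqnorm_orthogonal.
Qed.

End sphere.

Lemma measure_bigsetU_le d (T : measurableType d) (R : realType)
    (m : {measure set T -> \bar R}) (I : Type) (s : seq I) (F : I -> set T) :
  (forall i, measurable (F i)) ->
  (m (\big[setU/set0]_(i <- s) F i) <= \sum_(i <- s) m (F i))%E.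
Proof.
move=> mF; elim: s => [|i s IH]; first by rewrite !big_nil measure0.
rewrite !big_cons (le_trans (measureU2 _ (mF i) _))//.
  exact: bigsetU_measurable.
exact: leeD2l.
Qed.

Section cap_lower_bound.
Context (R : realType) (N : nat).
Variable nu : probability (borel_cV R N) R.
Hypothesis nu_unif : uniform_on_sphere nu.

Lemma sum_half_pow_le M : \sum_(m < M) (2^-1 : R) ^+ m <= 2.
Proof.
suff -> : \sum_(m < M) (2^-1 : R) ^+ m = 2 - 2 * 2^-1 ^+ M.
  by rewrite gerBl mulr_ge0// exprn_ge0.
elim: M => [|M IH]; first by rewrite big_ord0 expr0; ring.
by rewrite big_ord_recr /= IH exprS; field.
Qed.

(* [cell] rounds e to a grid of mesh r / sqrt N, so that two points of the same
   cell are r-close; the cells meeting the sphere are counted by weighting a cell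
   with 2 to the minus its l1 norm, which is at most q * N. *)
Lemma cap_measure_ge (q : nat) (r : R) (u : 'cV[R]_N) :
  (0 < N)%N -> 0 < r -> r ^- 2 <= q%:R -> sqnorm u = 1 ->
  (((4 * 2 ^+ q) ^- N)%:E <= nu (cap u r))%E.
Proof.
move=> N0 r0 rq u1.
(* The inverse mesh; on the sphere the squares of the rescaled coordinates sum to
   [k ^+ 2 <= q * N]. *)
pose k : R := Num.sqrt N%:R / r.
have k2 : k ^+ 2 = N%:R * r ^- 2 by rewrite expr_div_n sqr_sqrtr.
have k0 : 0 < k by rewrite divr_gt0// sqrtr_gt0 ltr0n.
have k2q : k ^+ 2 <= (q * N)%:R by rewrite k2 natrM mulrC ler_wpM2r.
pose M := (q * N).+1.
pose n (e : 'cV[R]_N) i := Num.truncn (`|e i 0| * k).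
have n_le e i : (n e i)%:R <= `|e i 0| * k.
  by rewrite /n truncn_le mulr_ge0// ltW.
have sumn_le e : sqnorm e = 1 -> (\sum_i n e i <= q * N)%N.
  move=> e1; rewrite -(ler_nat R) natr_sum (le_trans _ k2q)//.
  have -> : k ^+ 2 = \sum_i e i 0 ^+ 2 * k ^+ 2.
    by rewrite -mulr_suml -/(sqnorm e) e1 mul1r.
  apply: ler_sum => i _.
  have -> : e i 0 ^+ 2 * k ^+ 2 = (`|e i 0| * k) ^+ 2.
    by rewrite [RHS]exprMn real_normK ?num_real.
  (* A natural number is at most its square, which bounds the l1 norm by the squared l2 norm. *)
  apply: (@le_trans _ _ ((n e i)%:R ^+ 2)).
    by rewrite -natrX ler_nat; case: (n e i) => // m; rewrite leq_pmulr.
  by rewrite ler_pXn2r ?nnegrE// mulr_ge0// ltW.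
(* Signs are recorded apart, since [n] only sees absolute values. On the sphere every index is at
   most [q * N < M], so [inord] keeps it. *)
pose cell (e : 'cV[R]_N) : {ffun 'I_N -> bool * 'I_M} :=
  [ffun i => (0 <= e i 0, inord (n e i))].
have close e e' : sqnorm e = 1 -> sqnorm e' = 1 -> cell e = cell e' ->
    sqnorm (e - e') <= r ^+ 2.
  move=> e1 e'1 ee'.
  have rk : r ^+ 2 = \sum_(i < N) k ^- 2.
    rewrite sumr_const card_ord k2 -[RHS]mulr_natl.
    by field; rewrite pnatr_eq0 -lt0n N0 gt_eqF.
  rewrite rk; apply: ler_sum => i _; rewrite !mxE.
  have /ffunP/(_ i) := ee'; rewrite !ffunE => -[s12 n12].
  have ltM (e2 : 'cV[R]_N) : sqnorm e2 = 1 -> (n e2 i < M)%N.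
    move=> h; rewrite ltnS (leq_trans _ (sumn_le _ h))//.
    by rewrite (bigD1 i)//= leq_addr.
  have {}n12 : n e i = n e' i.
    by have := congr1 val n12; rewrite /= !inordK ?ltM.
  have lt1 (e2 : 'cV[R]_N) : `|e2 i 0| * k < (n e2 i)%:R + 1.
    by rewrite natr1 /n truncnS_gt.
  have d1 : `|e i 0 - e' i 0| * k <= 1.
    have := lt1 e; have := lt1 e'; have := n_le e i; have := n_le e' i.
    rewrite n12; set z := (n e' i)%:R => a1 a2 a3 a4.
    have -> : `|e i 0 - e' i 0| = `| `|e i 0| - `|e' i 0| |.
      case: (leP 0 (e i 0)) s12 => h1 /esym h2.
        by rewrite (ger0_norm h1) (ger0_norm h2).
      have {}h2 : e' i 0 < 0 by rewrite ltNge h2.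
      by rewrite (ltr0_norm h1) (ltr0_norm h2) -opprD normrN.
    rewrite -[X in _ * X](gtr0_norm k0) -normrM mulrBl ler_norml.
    by apply/andP; split; lra.
  rewrite -[leRHS]mul1r ler_pdivlMr ?exprn_gt0//.
  rewrite -(ger0_norm (sqr_ge0 (_ - _))) normrX -exprMn.
  by rewrite expr_le1// mulr_ge0// ltW.
pose S f := [set e : 'cV[R]_N | sqnorm e = 1 /\ cell e = f].
(* By [close], a cell that meets the sphere is covered there by the cap around any one of its
   points. *)
pose F f := if pselect (S f !=set0) is left h then cap (projT1 (cid h)) r else set0.
have mF f : measurable (F f).
  rewrite /F; case: pselect => [h|_]; [exact: measurable_cap|exact: measurable0].
(* This weight is at least 1 on every cell that meets the sphere, and it is a product over the
   coordinates. *)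
pose w (f : {ffun 'I_N -> bool * 'I_M}) : R := 2 ^+ (q * N) * \prod_i 2^-1 ^+ (f i).2.
have w0 (f : {ffun 'I_N -> bool * 'I_M}) : 0 <= w f.
  by rewrite mulr_ge0 ?exprn_ge0// prodr_ge0// => i _; rewrite exprn_ge0.
have Fw f : (nu (F f) <= nu (cap u r) * (w f)%:E)%E.
  rewrite /F; case: pselect => [h|_]; last by rewrite measure0 mule_ge0// lee_fin.
  case: cid => e [e1 ef] /=.
  rewrite (cap_measure_eq nu_unif r e1 u1) lee_pemulr//.
  rewrite lee_fin /w prodrXr.
  rewrite exprVn ler_pdivlMr ?exprn_gt0// mul1r ler_eXn2l ?ltr1n//.
  rewrite (leq_trans _ (sumn_le _ e1))// leq_sum// => i _.
  by rewrite -ef ffunE /= /inord val_insubd; case: ifP.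
have le1 : (1 <= nu (cap u r) * (\sum_f w f)%:E)%E.
  rewrite -nu_unif.1 -sumEFin ge0_sume_distrr; last by move=> f _; rewrite lee_fin.
  apply: (@le_trans _ _ (\sum_f nu (F f))%E); last exact: lee_sum.
  apply: le_trans (measure_bigsetU_le nu _ mF).
  apply: le_measure; rewrite ?inE.
  - exact: measurable_unit_sphere.
  - exact: bigsetU_measurable.
  move=> e /= e1; rewrite -bigcup_seq; exists (cell e); first exact: mem_index_enum.
  rewrite /F; case: pselect => [h|]; last by case; exists e.
  by case: cid => e' [e'1 /esym ef] /=; exact: close.
have sumw : \sum_f w f <= (4 * 2 ^+ q) ^+ N.
  (* Exchanging sum and product leaves one factor per coordinate: two signs times a geometric sum,
     at most 4. *)
  rewrite /w -mulr_sumr -(bigA_distr_bigA (fun _ (j : bool * 'I_M) => 2^-1 ^+ j.2)).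
  rewrite exprMn mulrC exprM ler_wpM2r ?exprn_ge0//.
  rewrite -[N in leRHS]card_ord -prodr_const; apply: ler_prod => i _.
  rewrite sumr_ge0 => [/=|j _]; last exact: exprn_ge0.
  rewrite -(pair_bigA _ (fun (b : bool) (j : 'I_M) => 2^-1 ^+ j))/=.
  rewrite sumr_const card_bool -[leRHS](_ : 2 *+ 2 = _ :> R); last by ring.
  by rewrite lerMn2r sum_half_pow_le.
have [p pE] : exists p : R, nu (cap u r) = p%:E.
  by exists (fine (nu (cap u r))); rewrite fineK// fin_num_measure//; exact: measurable_cap.
have p0 : 0 <= p by rewrite -lee_fin -pE measure_ge0.
move: le1; rewrite pE -EFinM !lee_fin => le1.
rewrite -[leLHS]mul1r ler_pdivrMr ?exprn_gt0 ?mulr_gt0 ?exprn_gt0//.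
by rewrite (le_trans le1)// ler_wpM2l.
Qed.

End cap_lower_bound.

(** * Bounds on the annealed free energy *)

(** Rounding [t] down to [k] changes the count [k (k - 1)] of ordered pairs from [t ^+ 2] by a term
    linear in [t] only. *)
Lemma truncn_prod_ge (R : realType) (t : R) : 2 <= t ->
  (t - 1) * (t - 2) <= (Num.truncn t)%:R * ((Num.truncn t)%:R - 1).
Proof.
move=> t2; have /andP[h1 h2] : (Num.truncn t)%:R <= t < (Num.truncn t).+1%:R.
  by apply: truncn_itv; lra.
by move: h1 h2; rewrite -natr1; set k : R := (Num.truncn t)%:R => h1 h2; nra.
Qed.

Section energy_lower.
Context (R : realType) (mu : probability (measurableTypeR R) R).
Hypothesis mu_sym : symmetric_law mu.
Variable A : R.
Hypothesis A_sup : A%:E = (2%:E * ereal_sup (range (psi mu)))%E.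
Variable K : R.
Hypothesis K0 : 0 < K.
Hypothesis ell_lip : forall s t, 0 <= s -> 0 <= t ->
  `|ell mu s - ell mu t| <= K * `|s - t|.

(** The constant is half of [r + 4 r]: the squared distance divided by [r], plus [r] times twice the
    two unit norms. *)
Lemma sum_sqr_dist N (e u : 'cV[R]_N) (r : R) : 0 < r ->
  sqnorm e = 1 -> sqnorm u = 1 -> sqnorm (e - u) <= r ^+ 2 ->
  \sum_i `|e i 0 ^+ 2 - u i 0 ^+ 2| <= 5 / 2 * r.
Proof.
move=> r0 e1 u1 eu.
(* AM-GM: [2 |x - y| |x + y| <= (x - y)^2 / r + r (x + y)^2] *)
have le_i i : `|e i 0 ^+ 2 - u i 0 ^+ 2| <=
    ((e - u) i 0 ^+ 2 / r + r * (2 * e i 0 ^+ 2 + 2 * u i 0 ^+ 2)) / 2.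
  rewrite !mxE subr_sqr normrM.
  set x := e i 0; set y := u i 0.
  have -> : (x - y) ^+ 2 / r = (`|x - y| / r) ^+ 2 * r.
    by rewrite expr_div_n real_normK ?num_real//; field; rewrite gt_eqF.
  have xy : `|x + y| ^+ 2 <= 2 * x ^+ 2 + 2 * y ^+ 2.
    rewrite real_normK ?num_real// -subr_ge0.
    by rewrite (_ : _ - _ = (x - y) ^+ 2) ?sqr_ge0//; ring.
  set a := `|x - y| / r; set b := `|x + y| in xy *.
  have -> : `|x - y| = a * r by rewrite /a divfK// gt_eqF.
  rewrite ler_pdivlMr//.
  have : 0 <= r * (2 * x ^+ 2 + 2 * y ^+ 2 - b ^+ 2) by rewrite mulr_ge0 ?subr_ge0// ltW.
  have : 0 <= r * (a - b) ^+ 2 by rewrite mulr_ge0 ?sqr_ge0// ltW.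
  by nra.
apply: le_trans (ler_sum _ (fun i _ => le_i i)) _.
rewrite -mulr_suml big_split/= -mulr_suml -mulr_sumr big_split/= -!mulr_sumr.
rewrite -/(sqnorm (e - u)) -/(sqnorm e) -/(sqnorm u) e1 u1.
have : sqnorm (e - u) / r <= r by rewrite ler_pdivrMr// -expr2.
by lra.
Qed.

(** The products of two squared coordinates move in l1 by at most twice what the squares do, and
    [pair_weight] is twice the multiplicity in [sum_sym_pairs]; hence [10 = 2 * 2 * (5 / 2)]. *)
Lemma energy_lipschitz N (theta : R) (e u : 'cV[R]_N) (r : R) : 0 < r ->
  sqnorm e = 1 -> sqnorm u = 1 -> sqnorm (e - u) <= r ^+ 2 ->
  energy mu theta u - 10 * K * N%:R * theta ^+ 2 * r <= energy mu theta e.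
Proof.
move=> r0 e1 u1 eu; rewrite lerBlDl -lerBlDr.
pose D := \sum_i `|e i 0 ^+ 2 - u i 0 ^+ 2|.
pose b i j := `|e i 0 ^+ 2 * e j 0 ^+ 2 - u i 0 ^+ 2 * u j 0 ^+ 2|.
have bC i j : b i j = b j i by rewrite /b [X in `|X - _|]mulrC [X in `|_ - X|]mulrC.
have sumb : \sum_i \sum_j b i j <= 2 * D.
  have le_ij i j : b i j <= `|e i 0 ^+ 2 - u i 0 ^+ 2| * e j 0 ^+ 2
       + u i 0 ^+ 2 * `|e j 0 ^+ 2 - u j 0 ^+ 2|.
    rewrite /b -{2}(ger0_norm (sqr_ge0 (e j 0))) -{3}(ger0_norm (sqr_ge0 (u i 0))).
    rewrite -!normrM (le_trans _ (ler_normD _ _))// le_eqVlt; apply/orP; left.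
    by apply/eqP; congr `|_|; ring.
  apply: le_trans (ler_sum _ (fun i _ => ler_sum _ (fun j _ => le_ij i j))) _.
  under eq_bigr do rewrite big_split/= -!mulr_sumr -/(sqnorm e) -/D e1 mulr1.
  by rewrite big_split/= -mulr_suml -/(sqnorm u) -/D u1 mul1r mulr_natl mulr2n.
have -> : 10 * K * N%:R * theta ^+ 2 * r = K * (N%:R * theta ^+ 2) * 2 * (2 * (5 / 2 * r)).
  by field.
have cN0 : 0 <= K * (N%:R * theta ^+ 2) * 2.
  by apply: mulr_ge0 => //; apply: mulr_ge0; [exact: ltW|rewrite mulr_ge0 ?sqr_ge0].
apply: (@le_trans _ _ (K * (N%:R * theta ^+ 2) * 2 * \sum_i \sum_j b i j)); last first.
  apply: ler_wpM2l => //; apply: le_trans sumb _; rewrite ler_pM2l//.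
  exact: sum_sqr_dist.
rewrite sum_sym_pairs// mulr_sumr /energy -sumrB; apply: ler_sum => p _.
have pw0 : 0 < pair_weight R p by rewrite /pair_weight; case: ifP.
have w0 : 0 <= pair_weight R p * (N%:R * theta ^+ 2).
  by apply: mulr_ge0; [exact: ltW|rewrite mulr_ge0 ?sqr_ge0].
apply: le_trans (ler_norm _) _.
have s0 (v : 'cV[R]_N) : 0 <= pair_weight R p * (N%:R * theta ^+ 2)
    * (v p.1 0 ^+ 2 * v p.2 0 ^+ 2) 
  by apply: mulr_ge0 => //; rewrite mulr_ge0 ?sqr_ge0.
apply: le_trans (ell_lip (s0 u) (s0 e)) _.
rewrite -mulrBr normrM (ger0_norm w0) distrC -/(b p.1 p.2) /pair_weight.
by case: ifP => _; rewrite le_eqVlt; apply/orP; left; apply/eqP; ring.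
Qed.

Definition block N k : 'cV[R]_N :=
  \col_(i < N) if (i < k)%N then (Num.sqrt k%:R)^-1 else 0.

Lemma block_sqr N k (i : 'I_N) : block N k i 0 ^+ 2 = (i < k)%:R / k%:R.
Proof.
rewrite mxE; case: ifP => _; last by rewrite expr0n mul0r.
by rewrite exprVn sqr_sqrtr// mul1r.
Qed.

Lemma sum_lt_ord N k : (k <= N)%N -> \sum_(i < N) ((i < k)%:R : R) = k%:R.
Proof.
move=> kN; rewrite -natr_sum; congr (_%:R).
rewrite -(big_mkord xpredT (fun i => ((i < k)%N : nat))) (big_cat_nat (leq0n k) kN)//=.
rewrite [X in (_ + X)%N]big_nat_cond [X in (_ + X)%N]big1 ?addn0; last first.
  by move=> i /andP[/andP[ki _] _]; rewrite ltnNge ki.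
rewrite big_nat (eq_bigr (fun=> 1%N)) => [|i /andP[_ ->]//].
by rewrite -big_nat sum_nat_const_nat muln1 subn0.
Qed.

Lemma sqnorm_block N k : (0 < k <= N)%N -> sqnorm (block N k) = 1.
Proof.
move=> /andP[k0 kN]; rewrite /sqnorm; under eq_bigr do rewrite block_sqr.
by rewrite -mulr_suml sum_lt_ord// divff// pnatr_eq0 -lt0n.
Qed.

Lemma ell0 : ell mu 0 = 0.
Proof. by rewrite /ell sqrtr0 log_laplace0. Qed.

(** Pairs outside the block contribute [ell 0 = 0], diagonal ones are dropped by positivity, and the
    [k (k - 1) / 2] others share one argument. *)
Lemma energy_block N k (theta : R) : (0 < k <= N)%N ->
  2^-1 * (k%:R * (k%:R - 1)) * ell mu (4 * (N%:R * theta ^+ 2) / k%:R ^+ 2)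
    <= energy mu theta (block N k).
Proof.
move=> /andP[k0 kN].
set E := ell mu _.
pose b (i j : 'I_N) : R :=
  2^-1 * E * ((i < k)%:R * (j < k)%:R * (1 - (i == j)%:R)).
have -> : 2^-1 * (k%:R * (k%:R - 1)) * E = \sum_i \sum_j b i j.
  rewrite /b; under eq_bigr do rewrite -mulr_sumr.
  rewrite -mulr_sumr mulrAC; congr (_ * _).
  have hi (i : 'I_N) : \sum_(j < N) (i < k)%:R * (j < k)%:R * (1 - (i == j)%:R)
      = (i < k)%:R * (k%:R - 1) :> R.
    rewrite (bigD1 i)//= eqxx subrr mulr0 add0r.
    under eq_bigr => j ji do rewrite eq_sym (negbTE ji) subr0 mulr1.
    rewrite -mulr_sumr -[in RHS](sum_lt_ord kN) [in RHS](bigD1 i)//=.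
    by case: (ltnP i k) => _; rewrite ?mul0r// mul1r addrAC subrr add0r mul1r.
  under eq_bigr do rewrite hi.
  by rewrite -mulr_suml sum_lt_ord.
rewrite sum_sym_pairs; last first.
  by move=> i j; rewrite /b eq_sym; ring.
apply: ler_sum => p _; rewrite /b /pair_weight !block_sqr.
case: eqVneq => _; rewrite ?subrr ?subr0 ?mulr0 ?mulr1.
  apply: (ell_ge0 mu_sym A_sup).
  apply: mulr_ge0; last by apply: mulr_ge0; exact: divr_ge0.
  by apply: mulr_ge0 => //; apply: mulr_ge0 => //; exact: sqr_ge0.
case: (ltnP p.1 k) => _; case: (ltnP p.2 k) => _ /=;
  rewrite ?(mul0r, mulr0, mul1r, mulr1, ell0)//.
rewrite mulVKf// /E.
rewrite le_eqVlt; apply/orP; left; apply/eqP; congr ell.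
by field; rewrite pnatr_eq0 -lt0n.
Qed.

(** At the real length [t] the argument of [ell] would be exactly [s]. Rounding costs a multiple of
    [t]: [3 / 2 * ell s] through the number of pairs and [K * s] through the argument. *)
Lemma block_energy_ge (a s theta t : R) N : 0 < s -> a / 2 * s <= ell mu s ->
  0 <= theta -> t = Num.sqrt N%:R * (2 * theta / Num.sqrt s) -> 2 <= t -> t <= N%:R ->
  a * N%:R * theta ^+ 2 - (3 / 2 * ell mu s + K * s) * t
    <= energy mu theta (block N (Num.truncn t)).
Proof.
move=> s0 ls th0 tE t2 tN.
have /andP[h1 h2] : (Num.truncn t)%:R <= t < (Num.truncn t).+1%:R.
  by apply: truncn_itv; lra.
set k := Num.truncn t in h1 h2 *.
have kN : (0 < k <= N)%N.
  apply/andP; split; last by rewrite -(ler_nat R) (le_trans h1 tN).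
  by rewrite -(ltr_nat R); move: h2; rewrite -natr1; lra.
apply: le_trans (energy_block theta kN).
have tt : t ^+ 2 * s = 4 * (N%:R * theta ^+ 2).
  rewrite tE exprMn sqr_sqrtr// expr_div_n sqr_sqrtr ?ltW//.
  by field; rewrite gt_eqF.
have k1 : 1 <= k%:R :> R by rewrite ler1n; case/andP: kN.
rewrite -tt; have := truncn_prod_ge t2; rewrite -/k.
move: h1 h2 k1; rewrite -natr1; set x : R := k%:R => h1 h2 k1 hx.
have l0 : 0 <= ell mu s by apply: (ell_ge0 mu_sym A_sup); exact: ltW.
set y := ell mu (t ^+ 2 * s / x ^+ 2).
have yl : ell mu s - K * s * (t ^+ 2 - x ^+ 2) / x ^+ 2 <= y.
  have : `|y - ell mu s| <= K * `|t ^+ 2 * s / x ^+ 2 - s|.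
    apply: ell_lip; last exact: ltW.
    by rewrite divr_ge0 ?sqr_ge0// mulr_ge0 ?sqr_ge0// ltW.
  rewrite (_ : t ^+ 2 * s / x ^+ 2 - s = s * (t ^+ 2 - x ^+ 2) / x ^+ 2); last first.
    by field; rewrite gt_eqF//; lra.
  rewrite (@ger0_norm _ (s * _ / _)); last first.
    by rewrite divr_ge0 ?sqr_ge0// mulr_ge0 ?(ltW s0)//; nra.
  by rewrite ler_norml !mulrA => /andP[+ _]; lra.
have xx : 0 <= x * (x - 1) by nra.
have hK : x * (x - 1) * (K * s * (t ^+ 2 - x ^+ 2) / x ^+ 2) <= 2 * (K * s) * t.
  have -> : x * (x - 1) * (K * s * (t ^+ 2 - x ^+ 2) / x ^+ 2)
      = K * s * ((t ^+ 2 - x ^+ 2) * (x - 1) / x).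
    by field; lra.
  rewrite (_ : 2 * (K * s) * t = K * s * (2 * t)); last by ring.
  rewrite ler_pM2l ?mulr_gt0//.
  rewrite ler_pdivrMr; last lra.
  have : (t ^+ 2 - x ^+ 2) <= 2 * t by nra.
  by nra.
have := ler_wpM2l xx yl; have := ler_wpM2r l0 hx.
have : 0 <= t ^+ 2 * (ell mu s - a / 2 * s) by rewrite mulr_ge0 ?sqr_ge0 ?subr_ge0.
have e3 : a * (t ^+ 2 * s) = 4 * (a * N%:R * theta ^+ 2) by rewrite tt; ring.
by nra.
Qed.

End energy_lower.

Section limn_esup_bounds.
Context (R : realType).
Local Open Scope ereal_scope.

Lemma limn_esup_le (u : (\bar R)^nat) c : (forall n, u n <= c) -> limn_esup u <= c.
Proof.
move=> uc; apply: (@le_trans _ _ (ereal_sup (u @` setT))).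
  by apply: ereal_inf_lbound; exists setT => //; exact: filterT.
by apply: ge_ereal_sup => _ [n _ <-].
Qed.

Lemma limn_esup_ge (u : (\bar R)^nat) c n0 :
  (forall n, (n0 <= n)%N -> c <= u n) -> c <= limn_esup u.
Proof.
move=> uc; apply: le_ereal_inf_tmp => _ [V [m _ mV] <-].
apply: (@le_trans _ _ (u (maxn n0 m))); first by apply: uc; rewrite leq_maxl.
by apply: ereal_sup_ubound; exists (maxn n0 m) => //; apply: mV; rewrite /= leq_maxr.
Qed.

End limn_esup_bounds.

(** * From the energy to bounds on [Fbar] *)

Section annealed_bounds.
Context (R : realType) (mu : probability (measurableTypeR R) R).
Hypothesis mu_sym : symmetric_law mu.
Variable A : R.
Hypothesis A_sup : A%:E = (2%:E * ereal_sup (range (psi mu)))%E.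
Context d (T : measurableType d) (P : probability T R).
Variable X : forall N, T -> 'M[R]_N.
Hypothesis X_wigner : forall N, (0 < N)%N -> wigner P mu (X N).
Variable nu : forall N, probability (borel_cV R N) R.
Hypothesis nu_unif : forall N, (0 < N)%N -> uniform_on_sphere (nu N).
Local Open Scope ereal_scope.

Let weight N theta (z : T * borel_cV R N) : \bar R :=
  (expR (N%:R * theta * quad_form (X N z.1) z.2))%:E.

Lemma measurable_annealed_weight N theta : (0 < N)%N ->
  measurable_fun setT (@weight N theta).
Proof.
move=> N0; apply/measurable_EFinP; apply: measurableT_comp => //.
apply: measurable_funM => //.
rewrite (_ : (fun _ => _) = (fun z : T * borel_cV R N =>
  \sum_i \sum_j z.2 i 0 * X N z.1 i j * z.2 j 0)%R); last first.
  by apply/funext => z; rewrite quad_formE.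
have mc i : measurable_fun setT (fun z : T * borel_cV R N => (z.2 : 'cV[R]_N) i 0%R).
  exact: (measurableT_comp (@measurable_coord R N i) measurable_snd).
apply: measurable_sum => i; apply: measurable_sum => j.
apply: measurable_funM => //; apply: measurable_funM => //.
exact: (measurableT_comp (wigner_measurable i j N0 (X_wigner N0)) measurable_fst).
Qed.

(** The function is the partial integral over the matrix of a jointly measurable weight, so Tonelli
    makes it measurable. *)
Lemma measurable_exp_energy N theta : (0 < N)%N ->
  measurable_fun setT (fun e : borel_cV R N => (expR (energy mu theta e))%:E).
Proof.
move=> N0; rewrite (_ : (fun _ => _) = fubini_G P (@weight N theta)); last first.
  apply/funext => e; rewrite /fubini_G /weight /=.
  by rewrite (wigner_mgf mu_sym A_sup theta e N0 (X_wigner N0)).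
have w0 (z : T * borel_cV R N) : 0 <= weight theta z by rewrite lee_fin expR_ge0.
exact: (measurable_fun_fubini_tonelli_G (@weight N theta)
  (measurable_annealed_weight theta N0) w0).
Qed.

Lemma unit_sphereC_null N : (0 < N)%N -> nu N (~` @unit_sphere R N) = 0.
Proof.
move=> N0; rewrite probability_setC ?(nu_unif N0).1 ?subee//.
exact: measurable_unit_sphere.
Qed.

(** Tonelli brings the matrix expectation inside, where [wigner_mgf] evaluates it; the restriction
    to the sphere makes the energy bounds available. *)
Lemma annealed_integralE N theta : (0 < N)%N ->
  \int[P]_w \int[nu N]_e (expR (N%:R * theta * quad_form (X N w) e))%:E
    = \int[nu N]_(e in @unit_sphere R N) (expR (energy mu theta e))%:E.
Proof.
move=> N0; have w0 (z : T * borel_cV R N) : 0 <= weight theta z by rewrite lee_fin expR_ge0.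
rewrite (fubini_tonelli (@weight N theta) (measurable_annealed_weight theta N0) w0).
transitivity (\int[nu N]_e (expR (energy mu theta e))%:E).
  by apply: eq_integral => e _; rewrite /weight /= (wigner_mgf mu_sym A_sup theta e N0 (X_wigner N0)).
have mS := @measurable_unit_sphere R N.
rewrite (@ge0_negligible_integral _ _ _ (nu N) setT (~` @unit_sphere R N))//.
- by rewrite setTD setCK.
- exact: measurableC.
- exact: measurable_exp_energy.
- exact: unit_sphereC_null.
Qed.

Lemma annealed_F0 N : annealed_F P X nu 0 N = 0.
Proof.
rewrite /annealed_F.
have int1 d' (T' : measurableType d') (Q : probability T' R) : \int[Q]_x (1%R)%:E = 1.
  by rewrite integral_cst// mul1e; exact: probability_setT.
under eq_integral => w _.
  under eq_integral do rewrite mulr0 mul0r expR0.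
  rewrite int1; over.
by rewrite int1 lne1 mule0.
Qed.

Lemma annealed_F_le theta N : annealed_F P X nu theta N <= (A * theta ^+ 2)%:E.
Proof.
(* At [N = 0] the factor [N%:R^-1] is 0, and so is the value; [0 <= A] comes from the bounds on
   [log_laplace] at 1. *)
case: (posnP N) => [->|N0].
  rewrite /annealed_F invr0 mul0e lee_fin mulr_ge0 ?sqr_ge0//.
  have : (0 <= A / 2 * 1 ^+ 2)%R.
    by rewrite -lee_fin (le_trans _ (log_laplace_le A_sup 1%R))// log_laplace_ge0.
  by rewrite expr1n mulr1; lra.
rewrite /annealed_F annealed_integralE//.
set I := \int[_]_(_ in _) _.
have Ile : I <= (expR (A * N%:R * theta ^+ 2))%:E.
  have mS := @measurable_unit_sphere R N.
  rewrite -[leRHS]mule1 -(nu_unif N0).1 -integral_cst//.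
  apply: ge0_le_integral => //.
  - by apply: measurable_funTS; exact: measurable_exp_energy.
  - by move=> e e1; rewrite lee_fin ler_expR (energy_le mu_sym A_sup).
have I0 : 0 <= I by apply: integral_ge0 => e _; rewrite lee_fin expR_ge0.
rewrite lee_pdivrMl ?ltr0n// -EFinM.
have -> : (N%:R * (A * theta ^+ 2))%:E = lne (expR (A * N%:R * theta ^+ 2))%:E.
  by rewrite lne_EFin ?expR_gt0// expRK; congr (_%:E); ring.
by rewrite lee_lne ?in_itv/= ?leey ?andbT// lee_fin expR_ge0.
Qed.

Lemma Fbar_le theta : Fbar P X nu theta <= (A * theta ^+ 2)%:E.
Proof. exact/limn_esup_le/annealed_F_le. Qed.

Lemma Fbar0 : Fbar P X nu 0 = 0.
Proof.
apply/eqP; rewrite eq_le; apply/andP; split.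
  by apply: limn_esup_le => n; rewrite annealed_F0.
by apply: (@limn_esup_ge _ _ _ 0) => n _; rewrite annealed_F0.
Qed.

Variable K : R.
Hypothesis K0 : (0 < K)%R.
Hypothesis ell_lip : forall s t, (0 <= s)%R -> (0 <= t)%R ->
  (`|ell mu s - ell mu t| <= K * `|s - t|)%R.

(** The integral is restricted to the cap of radius [r] around [u]. The mass of the cap costs
    [ln (4 * 2 ^+ q)] per dimension, whatever [N] and [theta] are. *)
Lemma annealed_F_ge theta N q (r : R) (u : 'cV[R]_N) : (0 < N)%N ->
  (0 < r)%R -> (r ^- 2 <= q%:R)%R -> sqnorm u = 1%R ->
  (N%:R^-1 * energy mu theta u - 10 * K * theta ^+ 2 * r - ln (4 * 2 ^+ q))%:E
    <= annealed_F P X nu theta N.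
Proof.
move=> N0 r0 rq u1; rewrite /annealed_F annealed_integralE//.
set I := \int[_]_(_ in _) _.
set c := (energy mu theta u - 10 * K * N%:R * theta ^+ 2 * r)%R.
have q0 : (0 < 4 * 2 ^+ q :> R)%R by rewrite mulr_gt0// exprn_gt0.
have leI : (expR c * (4 * 2 ^+ q) ^- N)%:E <= I.
  have mS := @measurable_unit_sphere R N.
  have mC := measurable_cap u r.
  have mSC : measurable (cap u r `&` @unit_sphere R N) by exact: measurableI.
  apply: (@le_trans _ _ (\int[nu N]_(e in cap u r `&` @unit_sphere R N) (cst (expR c)%:E) e)).
    rewrite integral_cst// EFinM lee_pmul2l ?lte_fin ?expR_gt0//.
    apply: le_trans (cap_measure_ge (nu_unif N0) N0 r0 rq u1) _.
    rewrite -[in leLHS](setIT (cap u r)) -(setvU (@unit_sphere R N)) setIUr.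
    rewrite setUC (le_trans (measureU2 _ mSC _))//.
      by apply: measurableI => //; exact: measurableC.
    rewrite [X in _ + X](_ : _ = 0) ?adde0//; apply/eqP; rewrite -measure_le0.
    rewrite -(unit_sphereC_null N0); apply: le_measure; rewrite ?inE.
    - by apply: measurableI => //; exact: measurableC.
    - exact: measurableC.
    - by move=> e [].
  apply: (@le_trans _ _ (\int[nu N]_(e in cap u r `&` @unit_sphere R N)
      (expR (energy mu theta e))%:E)).
    apply: ge0_le_integral => //.
    - by move=> e _; rewrite lee_fin expR_ge0.
    - by apply: measurable_funTS; exact: measurable_exp_energy.
    - by move=> e [eu e1]; rewrite lee_fin ler_expR; exact: energy_lipschitz.
  apply: ge0_subset_integral => //.
  by apply: measurable_funTS; exact: measurable_exp_energy.
have p0 : (0 < expR c * (4 * 2 ^+ q) ^- N)%R.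
  by rewrite mulr_gt0 ?expR_gt0// invr_gt0 exprn_gt0.
rewrite lee_pdivlMl ?ltr0n// -EFinM.
have I0 : 0 <= I by apply: integral_ge0 => e _; rewrite lee_fin expR_ge0.
apply: (@le_trans _ _ (lne (expR c * (4 * 2 ^+ q) ^- N)%:E)); last first.
  by rewrite lee_lne ?in_itv/= ?leey ?andbT// lee_fin ltW.
have qN0 : (0 < (4 * 2 ^+ q) ^+ N :> R)%R by rewrite exprn_gt0.
have lnE : (ln (expR c * (4 * 2 ^+ q) ^- N) = c - N%:R * ln (4 * 2 ^+ q))%R.
  rewrite lnM; [|by rewrite posrE expR_gt0|by rewrite posrE invr_gt0].
  rewrite expRK lnV ?posrE// lnXn//.
  by rewrite -[X in (_ - X)%R = _]mulr_natl.
rewrite lne_EFin// lee_fin lnE /c.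
rewrite le_eqVlt; apply/orP; left; apply/eqP; field.
by rewrite pnatr_eq0 -lt0n.
Qed.

Lemma Fbar_ge (a eta : R) : (1 < a)%R -> (a < A)%R -> (0 < eta)%R ->
  exists C : R, forall theta : R, (0 <= theta)%R ->
    ((a - eta) * theta ^+ 2 - C)%:E <= Fbar P X nu theta.
Proof.
move=> a1 aA eta0.
have [s s0 ls] := ell_near_sup mu_sym A_sup a1 aA.
(* This radius makes the Lipschitz loss [10 K theta^2 r] equal to [eta theta^2]. *)
pose r := (eta / (10 * K))%R.
have r0 : (0 < r)%R by rewrite divr_gt0// mulr_gt0.
pose q := (Num.truncn (r ^- 2)).+1.
have rq : (r ^- 2 <= q%:R)%R by rewrite ltW// truncnS_gt.
have lnq : (0 <= ln (4 * 2 ^+ q) :> R)%R.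
  by rewrite ln_ge0// -[leLHS]mulr1 ler_pM ?exprn_ege1//; lra.
(* The 1 absorbs the rounding loss [c * t <= N], the logarithm the mass of the cap. The case
   [theta = 0], where the block would be empty, is apart. *)
exists (1 + ln (4 * 2 ^+ q))%R => theta; rewrite le_eqVlt => /predU1P[<-|th0].
  by rewrite Fbar0 lee_fin expr0n/= mulr0; lra.
pose b := (2 * theta / Num.sqrt s)%R.
have b0 : (0 < b)%R by rewrite divr_gt0 ?mulr_gt0 ?sqrtr_gt0.
pose c := (3 / 2 * ell mu s + K * s)%R.
have c0 : (0 < c)%R.
  have := ell_ge0 mu_sym A_sup (ltW s0); have : (0 < K * s)%R by rewrite mulr_gt0.
  by rewrite /c; lra.
(* For [N >= n0] the root of [N] exceeds [2 / b], [b] and [c * b], which gives [2 <= t], [t <= N]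
   and [c * t <= N]. *)
pose n0 := (Num.truncn ((2 / b + b + c * b + 1) ^+ 2)).+1.
apply: (@limn_esup_ge _ _ _ n0) => N n0N.
have N0 : (0 < N)%N by exact: leq_trans n0N.
pose x : R := Num.sqrt N%:R.
have xx : (x ^+ 2 = N%:R)%R by rewrite sqr_sqrtr.
have x0 : (0 < x)%R by rewrite sqrtr_gt0 ltr0n.
have cb : (0 < c * b)%R by rewrite mulr_gt0.
have b2 : (0 < 2 / b)%R by rewrite divr_gt0.
have ltx : (2 / b + b + c * b + 1 < x)%R.
  rewrite -(@ltr_pXn2r _ 2)// ?nnegrE ?(ltW x0)//; last by lra.
  by rewrite xx (lt_le_trans (truncnS_gt _))// ler_nat.
pose t := (x * b)%R.
have t2 : (2 <= t)%R by rewrite -ler_pdivrMr//; lra.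
have tN : (t <= N%:R)%R by rewrite -xx expr2 ler_pM2l//; lra.
have kN : (0 < Num.truncn t <= N)%N.
  rewrite truncn_gt0 (le_trans _ t2) ?ler1n//= -(ler_nat R).
  by rewrite (le_trans _ tN)// truncn_le; lra.
have := block_energy_ge mu_sym A_sup K0 ell_lip s0 ls (ltW th0) (erefl t) t2 tN.
set E := energy _ _ _ => HE.
apply: le_trans (annealed_F_ge theta N0 r0 rq (sqnorm_block R kN)).
rewrite -/E lee_fin -xx.
have ct : (c * t <= x ^+ 2)%R.
  rewrite /t mulrCA expr2 ler_pM2l//; lra.
have HE' : (a * theta ^+ 2 - 1 <= (x ^+ 2)^-1 * E)%R.
  rewrite ler_pdivlMl ?exprn_gt0//; move: HE; rewrite -xx -/c; nra.
have -> : (10 * K * theta ^+ 2 * r = eta * theta ^+ 2)%R.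
  by rewrite /r; field; rewrite gt_eqF.
by lra.
Qed.

End annealed_bounds.

(** * Logarithmic potential of the semicircle law and the function J *)

Section log_bounds.
Context (R : realType).
Implicit Types t : R.

Lemma ln_sqr t : 0 < t -> ln (t ^+ 2) = 2 * ln t.
Proof. by move=> t0; rewrite lnXn// mulr2n mulrDl mul1r. Qed.

Lemma ln_le_sqrt t : 0 < t -> ln t <= 2 * Num.sqrt t.
Proof.
move=> t0; have st0 : 0 < Num.sqrt t by rewrite sqrtr_gt0.
rewrite -{1}(sqr_sqrtr (ltW t0)) ln_sqr// ler_pM2l// ltW//.
exact: ln_sublinear.
Qed.

Lemma ln1D_le_sqrt t : 0 <= t -> ln (1 + t) <= 2 * Num.sqrt t.
Proof.
move=> t0; have st0 := sqrtr_ge0 t.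
have h1 : 0 < 1 + Num.sqrt t by lra.
apply: (@le_trans _ _ (ln ((1 + Num.sqrt t) ^+ 2))).
  rewrite ler_ln ?posrE ?exprn_gt0//; last lra.
  by rewrite -{1}(sqr_sqrtr t0); nra.
by rewrite ln_sqr// ler_pM2l// le_ln1Dx//; lra.
Qed.

Lemma ln_ge_invr t : 0 < t -> - t^-1 <= ln t.
Proof.
move=> t0; rewrite lerNl -lnV ?posrE// ltW// ln_sublinear// invr_gt0//.
Qed.

(** The bound [ln_le_sqrt] at [t] and at [t^-1] controls both signs of the logarithm. *)
Lemma norm_ln_mul_sqrt t : 0 < t -> `|ln t| * Num.sqrt t <= 2 * (1 + t).
Proof.
move=> t0; have st0 : 0 < Num.sqrt t by rewrite sqrtr_gt0.
have tt : Num.sqrt t * Num.sqrt t = t by rewrite -expr2 sqr_sqrtr// ltW.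
have h1 := ln_le_sqrt t0.
have h2 : - ln t <= 2 * (Num.sqrt t)^-1.
  have tV0 : 0 < t^-1 by rewrite invr_gt0.
  by have := ln_le_sqrt tV0; rewrite lnV ?posrE// sqrtrV ?(ltW t0).
case: (ger0P (ln t)) => _.
  have := ler_wpM2r (ltW st0) h1; rewrite -mulrA tt; lra.
by have := ler_wpM2r (ltW st0) h2; rewrite mulfVK ?gt_eqF//; lra.
Qed.

End log_bounds.

Section semicircle_log_potential.
Context (R : realType).
Implicit Types (c z y : R).

Let D : set R := [set` `[(-2 : R), 2]%R].

Lemma semicircle_pdf_ge0 y : 0 <= semicircle_pdf y.
Proof.
rewrite /semicircle_pdf; case: ifP => // _.
by rewrite divr_ge0 ?sqrtr_ge0// mulr_ge0// pi_ge0.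
Qed.

(** On the support [4 - y^2 = (2 - y) (2 + y)] is at most [4 (z - y)]. This decay offsets the
    singularity of the logarithm at [y = z]. *)
Lemma semicircle_pdf_le y z : 2 <= z -> semicircle_pdf y <= Num.sqrt (z - y).
Proof.
move=> z2; rewrite /semicircle_pdf; case: ifP => [|_]; last exact: sqrtr_ge0.
rewrite ler_norml => /andP[y1 y2]; have pi2 := @pi_ge2 R.
rewrite ler_pdivrMr ?mulr_gt0 ?pi_gt0//.
apply: (@le_trans _ _ (Num.sqrt (z - y) * 2)); last first.
  by rewrite ler_wpM2l ?sqrtr_ge0//; lra.
have -> : 2 = Num.sqrt (2 ^+ 2) :> R by rewrite sqrtr_sqr ger0_norm.
by rewrite -sqrtrM ?ler_wsqrtr//; nra.
Qed.

Lemma semicircle_pdf_eq0 y z : 2 <= z -> z - y <= 0 -> semicircle_pdf y = 0.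
Proof.
move=> z2 zy; apply/eqP; rewrite eq_le semicircle_pdf_ge0 andbT.
by rewrite (le_trans (semicircle_pdf_le y z2))// ler0_sqrtr.
Qed.

Lemma semicircle_pdf_le1 y : semicircle_pdf y <= 1.
Proof.
rewrite /semicircle_pdf; case: ifP => // _; have pi2 := @pi_ge2 R.
rewrite ler_pdivrMr ?mulr_gt0 ?pi_gt0// mul1r.
apply: (@le_trans _ _ (Num.sqrt (2 ^+ 2))).
  by rewrite ler_wsqrtr//; have := sqr_ge0 y; lra.
by rewrite sqrtr_sqr ger0_norm//; lra.
Qed.

Lemma measurable_semicircle_pdf : measurable_fun setT (@semicircle_pdf R).
Proof.
(* Off the support the radicand is negative and [Num.sqrt] is 0, so one formula holds everywhere. *)
rewrite (_ : @semicircle_pdf R = fun y => Num.sqrt (4 - y ^+ 2) / (2 * pi)).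
  apply: measurable_funM => //; apply: measurableT_comp.
    by apply: continuous_measurable_fun; exact: sqrt_continuous.
  by apply: measurable_funB => //; exact: measurable_funX.
apply/funext => y; rewrite /semicircle_pdf; case: ifPn => // /negP y2.
rewrite ler0_sqrtr ?mul0r// subr_le0 leNgt; apply/negP => h; apply: y2.
by rewrite -(@ler_pXn2r _ 2)// ?nnegrE// real_normK ?num_real// expr2; lra.
Qed.

(** Logarithmic potential of the semicircle law, with the factor [c] kept inside the logarithm to
    match [J]. *)
Definition log_potential c z : R :=
  \int[lebesgue_measure]_(y in D) (ln (c * (z - y)) * semicircle_pdf y).

Lemma integral_semicircle (f : R -> R) :
  \int[lebesgue_measure]_y (f y * semicircle_pdf y)
    = \int[lebesgue_measure]_(y in D) (f y * semicircle_pdf y).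
Proof.
rewrite [RHS]Rintegral_mkcond; apply: eq_Rintegral => y _; rewrite patchE.
case: ifPn => // /negP yD; rewrite /semicircle_pdf ifF ?mulr0//.
apply/negP => y2; apply: yD; rewrite inE /D /= in_itv /=.
by rewrite ler_norml in y2.
Qed.

Lemma lebesgue_D : lebesgue_measure D = 4%:E.
Proof.
rewrite /D lebesgue_measure_itv/= lte_fin ifT; last lra.
by rewrite -EFinB; congr (_%:E); ring.
Qed.

Lemma integrable_log_potential c z : 0 < c -> 2 <= z ->
  lebesgue_measure.-integrable D
    (EFin \o (fun y => ln (c * (z - y)) * semicircle_pdf y)).
Proof.
move=> c0 z2; apply: measurable_bounded_integrable.
- exact: measurable_itv.
- by rewrite [X in (X < _)%E]lebesgue_D ltry.
- apply: measurable_funTS; apply: measurable_funM; last exact: measurable_semicircle_pdf.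
  apply: measurableT_comp => //; apply: measurable_funM => //.
  exact: measurable_funB.
(* The bound is [norm_ln_mul_sqrt] at [c * (z - y)], with [z - y <= z + 2] and the density at most
   [Num.sqrt (z - y)]. *)
exists (2 * (1 + c * (z + 2)) / Num.sqrt c); split => [|M ltM]; first exact: num_real.
move=> y; rewrite /D /= in_itv /= => /andP[y1 y2]; apply: le_trans (ltW ltM).
rewrite normrM (ger0_norm (semicircle_pdf_ge0 y)).
have sc0 : 0 < Num.sqrt c by rewrite sqrtr_gt0.
have [zy|zy] := leP (z - y) 0.
  by rewrite (semicircle_pdf_eq0 z2 zy) mulr0 divr_ge0 ?(ltW sc0)// mulr_ge0 ?addr_ge0 ?mulr_ge0 ?(ltW c0)//; lra.
rewrite ler_pdivlMr//; apply: (@le_trans _ _ (2 * (1 + c * (z - y)))).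
  apply: le_trans (norm_ln_mul_sqrt (mulr_gt0 c0 zy)).
  have -> : Num.sqrt (c * (z - y)) = Num.sqrt (z - y) * Num.sqrt c.
    by rewrite sqrtrM ?(ltW c0)// mulrC.
  rewrite mulrA; apply: ler_wpM2r; first exact: ltW.
  by apply: ler_wpM2l => //; exact: semicircle_pdf_le.
by rewrite ler_pM2l// lerD2l ler_pM2l//; lra.
Qed.

(** The factor 4 is the length of [D]. *)
Lemma Rintegral_D_le (f g : R -> R) (M : R) :
  lebesgue_measure.-integrable D (EFin \o f) ->
  lebesgue_measure.-integrable D (EFin \o g) ->
  (forall y, D y -> f y <= g y + M) ->
  \int[lebesgue_measure]_(y in D) f y
    <= \int[lebesgue_measure]_(y in D) g y + 4 * M.
Proof.
move=> intf intg fgM.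
have mD : measurable (D : set (measurableTypeR R)) by exact: measurable_itv.
have intM : lebesgue_measure.-integrable D (EFin \o cst M).
  apply: measurable_bounded_integrable => //.
    by rewrite [X in (X < _)%E]lebesgue_D ltry.
  by exists `|M|; split => [|N ltN y _]; [exact: num_real|exact: ltW].
have -> : 4 * M = \int[lebesgue_measure]_(y in D) cst M y.
  rewrite Rintegral_cst// mulrC; congr (_ * _).
  exact: (esym (congr1 fine lebesgue_D)).
rewrite -RintegralD//; apply: le_Rintegral => //.
exact: (integrableD mD intg intM).
Qed.

Let integrable0 : lebesgue_measure.-integrable D (EFin \o (fun=> 0 : R)).
Proof. exact: integrable0. Qed.

Let Rintegral0 : \int[lebesgue_measure]_(y in D) (0 : R) = 0.
Proof. by rewrite Rintegral_cst ?mul0r//; exact: measurable_itv. Qed.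

Lemma log_potential_ler c z z' : 0 < c -> 2 <= z -> z <= z' ->
  log_potential c z <= log_potential c z'.
Proof.
move=> c0 z2 zz'; rewrite -[leRHS]addr0 -[X in _ + X](mulr0 4).
apply: Rintegral_D_le; try by apply: integrable_log_potential => //; lra.
move=> y _; rewrite addr0; have [zy|zy] := leP (z - y) 0.
  by rewrite (semicircle_pdf_eq0 z2 zy) !mulr0.
rewrite ler_wpM2r ?semicircle_pdf_ge0// ler_ln ?posrE ?mulr_gt0 ?ler_pM2l//; lra.
Qed.

(** The logarithms differ by [ln (1 + (z' - z) / (z - y))], at most twice the root of the quotient;
    the density cancels the root of [z - y]. *)
Lemma log_potential_holder c z z' : 0 < c -> 2 <= z -> z <= z' ->
  log_potential c z' <= log_potential c z + 8 * Num.sqrt (z' - z).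
Proof.
move=> c0 z2 zz'.
rewrite (_ : 8 * Num.sqrt (z' - z) = 4 * (2 * Num.sqrt (z' - z))); last by ring.
apply: Rintegral_D_le; try by apply: integrable_log_potential => //; lra.
move=> y _; have [zy|zy] := leP (z - y) 0.
  by rewrite (semicircle_pdf_eq0 z2 zy) !mulr0 add0r mulr_ge0 ?sqrtr_ge0.
have zy' : 0 < z' - y by lra.
rewrite -lerBlDl -mulrBl !lnM ?posrE//.
have -> : ln c + ln (z' - y) - (ln c + ln (z - y)) = ln (1 + (z' - z) / (z - y)).
  rewrite (_ : 1 + _ / _ = (z' - y) / (z - y)); last by field; rewrite gt_eqF.
  by rewrite ln_div ?posrE//; ring.
have h0 : 0 <= (z' - z) / (z - y) by rewrite divr_ge0 ?(ltW zy)// subr_ge0.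
apply: (@le_trans _ _ (2 * Num.sqrt ((z' - z) / (z - y)) * Num.sqrt (z - y))).
  apply: ler_pM; rewrite ?semicircle_pdf_ge0 ?semicircle_pdf_le//.
    by rewrite ln_ge0// lerDl.
  exact: ln1D_le_sqrt.
by rewrite -mulrA -sqrtrM// divfK// gt_eqF.
Qed.

Lemma log_potential_le c z : 0 < c -> 2 <= z ->
  log_potential c z <= 8 * Num.sqrt (c * (z + 2)).
Proof.
move=> c0 z2; rewrite -[leRHS]add0r -[X in X + _]Rintegral0.
rewrite (_ : 8 * Num.sqrt (c * (z + 2)) = 4 * (2 * Num.sqrt (c * (z + 2)))); last by ring.
apply: Rintegral_D_le => //; first exact: integrable_log_potential.
move=> y; rewrite /D /= in_itv /= add0r => /andP[y1 y2].
have M0 : 0 <= 2 * Num.sqrt (c * (z + 2)) by rewrite mulr_ge0 ?sqrtr_ge0.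
have [zy|zy] := leP (z - y) 0; first by rewrite (semicircle_pdf_eq0 z2 zy) mulr0.
have lnM : ln (c * (z - y)) <= 2 * Num.sqrt (c * (z + 2)).
  apply: le_trans (ln_le_sqrt (mulr_gt0 c0 zy)) _.
  by rewrite ler_pM2l// ler_wsqrtr// ler_pM2l//; lra.
have := semicircle_pdf_ge0 y; have := semicircle_pdf_le1 y.
set p := semicircle_pdf y; set l := ln _ in lnM *; set M := 2 * _ in M0 lnM *.
by move=> p1 p0; nra.
Qed.

(** For [z >= 4] one has [z - y >= z / 2] on the support, so the logarithm has argument at least 1/2
    and is at least -2. *)
Lemma log_potential_ge c z : 0 < c -> 4 <= z -> 1 <= c * z ->
  -8 <= log_potential c z.
Proof.
move=> c0 z4 cz; have z2 : 2 <= z by lra.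
suff : 0 <= log_potential c z + 4 * 2 by lra.
rewrite -[leLHS]Rintegral0.
apply: Rintegral_D_le => //; first exact: integrable_log_potential.
move=> y; rewrite /D /= in_itv /= => /andP[y1 y2].
have h : 2^-1 <= c * (z - y).
  apply: (@le_trans _ _ (c * (z / 2))); first by lra.
  by rewrite ler_pM2l//; lra.
have h0 : 0 < c * (z - y) by lra.
have lnM : - 2 <= ln (c * (z - y)).
  apply: le_trans (ln_ge_invr h0); rewrite lerN2 -[leRHS]invrK lef_pV2 ?posrE//.
have := semicircle_pdf_ge0 y; have := semicircle_pdf_le1 y.
set p := semicircle_pdf y; set l := ln _ in lnM *.
by move=> p1 p0; nra.
Qed.

End semicircle_log_potential.

(** * Regularity and growth of [J] *)

Section J_bounds.
Context (R : realType).
Implicit Types (x theta : R).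

(* With this effective position, 1 + 2 theta v - 2 theta y = 2 theta (zJ - y) in
   both regimes of v. *)
Definition zJ x theta : R :=
  if 2 * theta <= 1 then Num.max (2 * theta + (2 * theta)^-1) x else x.

(** The roots of this quadratic solve [t + t^-1 = x], so its sign decides which term of the maximum
    in [zJ] prevails. *)
Lemma Gsigma_spec x : 2 <= x ->
  0 < Gsigma x <= 1 /\ (forall t, (t - Gsigma x) * (t - (x - Gsigma x)) = t ^+ 2 - x * t + 1).
Proof.
move=> x2; rewrite /Gsigma; set s := Num.sqrt _.
have s0 : 0 <= s by exact: sqrtr_ge0.
have ss : s ^+ 2 = x ^+ 2 - 4 by rewrite sqr_sqrtr//; nra.
split; last by move=> t; rewrite !expr2 in ss *; nra.
have : s < x by nra.
have : x - 2 <= s by nra.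
by move=> h1 h2; apply/andP; split; lra.
Qed.

Lemma vJ_zJ x theta : 2 <= x -> 0 < theta ->
  vJ x theta = zJ x theta - (2 * theta)^-1.
Proof.
move=> x2 th0; have [/andP[G0 G1] /(_ (2 * theta)) GE] := Gsigma_spec x2.
have t0 : 0 < 2 * theta by lra.
rewrite /vJ /zJ; set t := 2 * theta in t0 GE *; set G := Gsigma x in G0 G1 GE *.
have tE : t + t^-1 - x = (t ^+ 2 - x * t + 1) / t by field; rewrite gt_eqF.
have tV0 : 0 < t^-1 by rewrite invr_gt0.
case: ifPn => [tG|/negP tG].
  rewrite ifT; last by lra.
  rewrite max_l; first by rewrite addrK.
  by rewrite -subr_ge0 tE -GE mulr_ge0 ?(ltW tV0)//; nra.
have {}tG : G < t by rewrite ltNge; apply/negP.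
case: ifPn => // t1; rewrite max_r//.
by rewrite -subr_le0 tE -GE pmulr_lle0//; nra.
Qed.

Lemma zJ_ge x theta : x <= zJ x theta.
Proof. by rewrite /zJ; case: ifP => _ //; rewrite le_max lexx orbT. Qed.

Lemma zJ_lipschitz x x' theta : `|zJ x theta - zJ x' theta| <= `|x - x'|.
Proof.
rewrite /zJ; case: ifP => _ //; set a := 2 * theta + _.
rewrite !maxEle; case: (leP a x) => h1; case: (leP a x') => h2 //.
- by rewrite !ger0_norm; lra.
- by rewrite (distrC x) (distrC a) !ger0_norm; lra.
- by rewrite subrr normr0.
Qed.

Lemma JE x theta : 2 <= x -> 0 < theta ->
  J x theta = theta * zJ x theta - 2^-1
    - 2^-1 * log_potential (2 * theta) (zJ x theta).
Proof.
move=> x2 th0; rewrite /J integral_semicircle /log_potential vJ_zJ//.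
have -> : theta * (zJ x theta - (2 * theta)^-1) = theta * zJ x theta - 2^-1.
  by field; rewrite gt_eqF.
congr (_ - _ * _); apply: eq_Rintegral => y _; congr (ln _ * _).
by field; rewrite gt_eqF.
Qed.

Lemma J0 x : 2 <= x -> J x 0 = 0.
Proof.
move=> x2; have [/andP[G0 _] _] := Gsigma_spec x2.
rewrite /J /vJ mulr0 (ltW G0) mulr0 sub0r.
rewrite (_ : \int[_]_y _ = 0) ?mulr0 ?oppr0//.
rewrite /Rintegral; under eq_integral do rewrite mul0r subr0 addr0 ln1 mul0r.
by rewrite integral0.
Qed.

(** The linear part uses that [zJ] is 1-Lipschitz. The potential enters with a minus sign: it is
    bounded by its Hölder estimate if [z <= z'] and by monotonicity otherwise. *)
Lemma J_modulus x x' theta : 0 <= theta -> 2 <= x -> 2 <= x' ->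
  J x theta - J x' theta <= theta * `|x - x'| + 4 * Num.sqrt `|x - x'|.
Proof.
move=> th0 x2 x'2; have s0 := sqrtr_ge0 `|x - x'|.
have := th0; rewrite le_eqVlt => /predU1P[<-|thp].
  by rewrite !J0// mul0r; lra.
rewrite !JE//; have := zJ_lipschitz x x' theta.
have := le_trans x2 (zJ_ge x theta); have := le_trans x'2 (zJ_ge x' theta).
set z := zJ x theta; set z' := zJ x' theta => z'2 z2 zz'.
have c0 : 0 < 2 * theta by lra.
have h1 : theta * (z - z') <= theta * `|x - x'|.
  by rewrite ler_pM2l// (le_trans (ler_norm _)).
have [le_zz'|/ltW le_z'z] := leP z z'.
  have := log_potential_holder c0 z2 le_zz'.
  have : Num.sqrt (z' - z) <= Num.sqrt `|x - x'|.
    by rewrite ler_wsqrtr// (le_trans _ zz')// distrC ler_norm.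
  by lra.
have := log_potential_ler c0 z'2 le_z'z; lra.
Qed.

Lemma J_ge x theta : 2 <= x -> 1 < 2 * theta ->
  theta * x - 2^-1 - 4 * Num.sqrt (2 * theta * (x + 2)) <= J x theta.
Proof.
move=> x2 th1; have th0 : 0 < theta by lra.
have c0 : 0 < 2 * theta by lra.
rewrite JE// (_ : zJ x theta = x); last by rewrite /zJ ifF//; apply/negbTE; rewrite -ltNge.
by have := log_potential_le c0 x2; lra.
Qed.

(** Moving from [x] to [zJ] costs at most 1, because the maximum only occurs for [2 * theta <= 1];
    the potential costs at most 4. *)
Lemma J_le x theta : 4 <= x -> 0 <= theta -> J x theta <= theta * x + 5.
Proof.
move=> x4; have x2 : 2 <= x by lra.
rewrite le_eqVlt => /predU1P[<-|th0]; first by rewrite J0//; lra.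
rewrite JE//; have z4 := le_trans x4 (zJ_ge x theta).
have c0 : 0 < 2 * theta by lra.
have [cz thz] : 1 <= 2 * theta * zJ x theta /\ theta * zJ x theta <= theta * x + 1.
  have tt : 2 * theta * (2 * theta)^-1 = 1 by rewrite divff// gt_eqF.
  rewrite /zJ; case: ifPn => [t1|]; last by rewrite -ltNge => t1; split; nra.
  case: (leP x (2 * theta + (2 * theta)^-1)) => h; split.
  - by rewrite mulrDr tt; have := sqr_ge0 (2 * theta); rewrite expr2; lra.
  - by rewrite -(ler_pM2l (ltr0Sn R 1)) mulrDr; nra.
  - by have := ler_wpM2l (ltW c0) (ltW h); rewrite mulrDr tt; nra.
  - by lra.
by have := log_potential_ge c0 z4 cz; lra.
Qed.

End J_bounds.

(** * The rate function *)

Section rate_function.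
Context (R : realType) (A : R) (F : R -> \bar R).
Hypothesis A_gt1 : 1 < A.
Hypothesis F_0 : F 0 = 0%E.
Hypothesis F_le : forall theta, (F theta <= (A * theta ^+ 2)%:E)%E.
Hypothesis F_ge : forall a, 1 < a -> a < A -> exists C : R, forall theta,
  0 <= theta -> ((a * theta ^+ 2 - C)%:E <= F theta)%E.

(** [Ibar] for an abstract free energy [F], known through its value at 0 and its quadratic
    bounds. *)
Let rate (y : R) : \bar R := if y < 2 then +oo%E else
  ereal_sup [set ((J y theta)%:E - F theta)%E | theta in [set theta | 0 <= theta]].

Let F_fin theta : 0 <= theta -> F theta = (fine (F theta))%:E.
Proof.
move=> th0; have A1 := A_gt1; have h1 : 1 < (1 + A) / 2 by lra.
have h2 : (1 + A) / 2 < A by lra.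
have [C CF] := F_ge h1 h2; have := CF _ th0; have := F_le theta.
by case: (F theta) => // [|]; rewrite ?leye_eq ?leeNy_eq.
Qed.

Lemma rate_ge_J y theta : 0 <= theta -> ((J y theta)%:E - F theta <= rate y)%E.
Proof.
move=> th0; rewrite /rate; case: ifP => _; first exact: leey.
by apply: ereal_sup_ubound; exists theta.
Qed.

Lemma rate_ge0 y : (0 <= rate y)%E.
Proof.
rewrite /rate; case: (ltP y 2) => // y2; apply: ereal_sup_ubound.
by exists 0 => //=; rewrite J0// F_0 sube0.
Qed.

Lemma rate_lower_semicontinuous : lower_semicontinuous rate.
Proof.
move=> x c; rewrite {1}/rate; case: (ltP x 2) => x2.
  move=> _; exists [set y | y < 2] => [|y /= y2].
    exact: lt_nbhsl.
  by rewrite /rate y2 ltry.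
move=> /ereal_sup_gt[_ [theta /= th0 <-]].
rewrite (F_fin th0) -EFinB lte_fin; set f := fine _ => cJ.
(* With [h] the distance from [y] to [x], [h < 1] and [h < e ^+ 2] give [h <= sqrt h < e], so the
   modulus of [J] stays below [(theta + 5) * e], the gap to be preserved. *)
pose e := (J x theta - f - c) / (theta + 5).
have e0 : 0 < e by rewrite divr_gt0//; lra.
exists (ball x (Num.min 1 (e ^+ 2))) => [|y].
  by apply: nbhsx_ballx; rewrite lt_min ltr01 exprn_gt0.
rewrite /ball /= lt_min => /andP[h1 he].
have [y2|y2] := ltP y 2; first by rewrite /rate y2 ltry.
apply: lt_le_trans (rate_ge_J y th0); rewrite (F_fin th0) -EFinB lte_fin -/f.
have := J_modulus th0 x2 y2.
have := normr_ge0 (x - y); move: h1 he; set h := `|x - y| => h1 he h0.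
have s0 := sqrtr_ge0 h; have ss : Num.sqrt h ^+ 2 = h by rewrite sqr_sqrtr.
have s1 : Num.sqrt h < 1 by rewrite -(@ltr_pXn2r _ 2) ?nnegrE// ss expr1n.
have se : Num.sqrt h < e by rewrite -(@ltr_pXn2r _ 2) ?nnegrE ?(ltW e0)// ss.
have hs : h <= Num.sqrt h by rewrite -[leLHS]ss expr2 ler_piMr// ltW.
have eE : e * (theta + 5) = J x theta - f - c by rewrite /e divfK// gt_eqF//; lra.
have : theta * h <= theta * Num.sqrt h by rewrite ler_wpM2l.
have : (theta + 5) * Num.sqrt h < (theta + 5) * e by rewrite ltr_pM2l//; lra.
by lra.
Qed.

(** The choice [theta = y / (2 A)] maximizes [theta y - A theta^2]; [A + 2 <= y] places it in the
    range of [J_ge]. *)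
Lemma rate_ge y : A + 2 <= y -> ((y ^+ 2 / (4 * A) - 4 * y - 9)%:E <= rate y)%E.
Proof.
move=> yA; pose theta := y / (2 * A).
have A1 := A_gt1; have A0 : 0 < A by lra.
have th0 : 0 <= theta by rewrite divr_ge0//; lra.
apply: le_trans (rate_ge_J y th0).
apply: (@le_trans _ _ ((J y theta)%:E - (A * theta ^+ 2)%:E)%E); last first.
  by apply: leeB.
rewrite -EFinB lee_fin.
have t2 : 2 * theta = y / A by rewrite /theta; field; rewrite gt_eqF.
have y2 : 2 <= y by lra.
have th1 : 1 < 2 * theta by rewrite t2 ltr_pdivlMr//; lra.
have := J_ge y2 th1.
have : Num.sqrt (2 * theta * (y + 2)) <= y + 2.
  rewrite -[leRHS](ger0_norm (x := y + 2)); last lra.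
  rewrite -sqrtr_sqr ler_wsqrtr// expr2 ler_pM2r; last lra.
  by rewrite t2 ler_pdivrMr//; nra.
have -> : A * theta ^+ 2 = y ^+ 2 / (4 * A) by rewrite /theta; field; rewrite gt_eqF.
have -> : theta * y = y ^+ 2 / (4 * A) + y ^+ 2 / (4 * A).
  by rewrite /theta; field; rewrite gt_eqF.
by lra.
Qed.

(** Completing the square bounds [theta y - a theta^2] by [y^2 / (4 a)] for every [theta]. *)
Lemma rate_le a : 1 < a -> a < A -> exists C : R, forall y, 4 <= y ->
  (rate y <= (y ^+ 2 / (4 * a) + C)%:E)%E.
Proof.
move=> a1 aA; have [C CF] := F_ge a1 aA; exists (5 + C) => y y4.
rewrite /rate ltNge (_ : 2 <= y)/=; last by lra.
apply: ge_ereal_sup => _ [theta /= th0 <-].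
have := CF _ th0; rewrite (F_fin th0) -EFinB !lee_fin; set f := fine _ => hf.
have := J_le y4 th0.
have : 0 <= a * (theta - y / (2 * a)) ^+ 2 by rewrite mulr_ge0 ?sqr_ge0//; lra.
rewrite (_ : a * _ = a * theta ^+ 2 - theta * y + y ^+ 2 / (4 * a)); last first.
  by field; rewrite gt_eqF//; lra.
by lra.
Qed.

Lemma rate_fin y : A + 4 <= y -> rate y = (fine (rate y))%:E.
Proof.
move=> yA; have A1 := A_gt1; have h1 : 1 < (1 + A) / 2 by lra.
have h2 : (1 + A) / 2 < A by lra.
have y4 : 4 <= y by lra.
have [C /(_ y y4)] := rate_le h1 h2; have := rate_ge0 y.
by case: (rate y) => // [|]; rewrite ?leye_eq ?leeNy_eq.
Qed.

Lemma rate_equiv :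
  (rate x * ((x ^+ 2 / (4 * A))^-1)%:E)%E @[x --> +oo] --> 1%:E.
Proof.
have A1 := A_gt1; have A0 : 0 < A by lra.
apply/fine_cvgP; split.
  near=> x; have xA : A + 4 <= x by near: x; exact/nbhs_pinfty_ge/num_real.
  by rewrite (rate_fin xA).
apply/cvgrPdist_le => eps eps0.
(* The first bound keeps [A - del > 1] and gives [A / (A - del) <= 1 + del]; the second makes that
   error half of [eps], the other half being for [C0]. *)
pose del := Num.min ((A - 1) / 2) (eps / 2).
have d0 : 0 < del by rewrite lt_min !divr_gt0//; lra.
have dA : del <= (A - 1) / 2 by rewrite ge_min lexx.
have de : del <= eps / 2 by rewrite ge_min lexx orbT.
have a1 : 1 < A - del by lra.
have aA : A - del < A by lra.
have [C0 hC0] := rate_le a1 aA.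
pose C := `|C0|.
near=> x.
have xA : A + 4 <= x by near: x; exact/nbhs_pinfty_ge/num_real.
(* The two thresholds absorb the linear loss of [rate_ge] and the constant of [rate_le]. *)
have xe : 50 * A / eps <= x by near: x; exact/nbhs_pinfty_ge/num_real.
have xC : 4 * A * C / (eps / 2) <= x by near: x; exact/nbhs_pinfty_ge/num_real.
have x4 : 4 <= x by lra.
have x0 : 0 < x by lra.
have xA' : A + 2 <= x by lra.
have := hC0 _ x4; have := rate_ge xA'.
rewrite /= (rate_fin xA) /= !lee_fin; set g := fine _ => g1 g2.
move: xe xC; rewrite ler_pdivrMr// ler_pdivrMr; last lra.
move=> xe xC.
have CC0 : C0 <= C by exact: ler_norm.
have C_ge0 : 0 <= C by exact: normr_ge0.
have a0 : 0 < A - del by lra.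
rewrite distrC ler_norml invf_div.
have -> : g * (4 * A / x ^+ 2) - 1 = (g * (4 * A) - x ^+ 2) / x ^+ 2.
  by field; rewrite gt_eqF.
have xx0 : 0 < x ^+ 2 by rewrite exprn_gt0.
rewrite ler_pdivlMr// ler_pdivrMr//; apply/andP; split.
  have : 4 * A * (x ^+ 2 / (4 * A) - 4 * x - 9) <= 4 * A * g.
    by rewrite ler_pM2l// mulr_gt0.
  rewrite (_ : 4 * A * (x ^+ 2 / (4 * A) - 4 * x - 9)
    = x ^+ 2 - 4 * A * (4 * x + 9)); last by field; rewrite gt_eqF.
  have : 50 * A * x <= x * eps * x by rewrite ler_pM2r.
  by nra.
have : 4 * A * g <= 4 * A * (x ^+ 2 / (4 * (A - del)) + C0).
  by rewrite ler_pM2l// mulr_gt0.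
have : 4 * A * (x ^+ 2 / (4 * (A - del))) <= x ^+ 2 * (1 + del).
  rewrite (_ : 4 * A * _ = x ^+ 2 * (A / (A - del))); last first.
    by field; rewrite gt_eqF.
  by rewrite ler_pM2l// ler_pdivrMr//; nra.
have : 4 * A * C <= x ^+ 2 * (eps / 2).
  by apply: le_trans xC _; rewrite ler_pM2r; nra.
have : x ^+ 2 * del <= x ^+ 2 * (eps / 2) by rewrite ler_pM2l.
have : 4 * A * C0 <= 4 * A * C by rewrite ler_pM2l//; lra.
by lra.
Unshelve. all: by end_near. Qed.

Lemma rate_compact c : compact [set x | (rate x <= c%:E)%E].
Proof.
(* Beyond [M], [w = x / (4 A)] exceeds 14 plus the absolute value of [c], so
   [x w - 4 x - 9 >= w - 13 > c] and [rate_ge] excludes [x]. *)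
pose M := A + 2 + 4 * A * (14 + `|c|).
apply: (@subclosed_compact _ _ `[2, M]%classic).
- rewrite (_ : [set _ | _] = ~` [set x | (c%:E < rate x)%E]); last first.
    by apply/seteqP; split => x /=; [rewrite leNgt => /negP|move=> /negP; rewrite -leNgt].
  apply: open_closedC.
  exact: (proj1 (lower_semicontinuousP rate) rate_lower_semicontinuous).
- exact: segment_compact.
move=> x /= xc; rewrite in_itv /=; apply/andP; split.
  by rewrite leNgt; apply/negP => x2; move: xc; rewrite /rate x2 leye_eq.
rewrite leNgt; apply/negP => Mx.
have c0 := normr_ge0 c; have cc := ler_norm c.
have A1 := A_gt1; have A0 : 0 < A by lra.
have Ac : 0 <= 4 * A * (14 + `|c|) by rewrite mulr_ge0 ?mulr_ge0//; lra.
have xA : A + 2 <= x by move: Mx; rewrite /M; lra.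
have := le_trans (rate_ge xA) xc; rewrite lee_fin.
have : 14 + `|c| <= x / (4 * A).
  by rewrite ler_pdivlMr ?mulr_gt0// mulrC; move: Mx; rewrite /M; lra.
rewrite expr2 -mulrA; set w := x / (4 * A) => w1 w2.
clear xc.
have : 0 <= (x - 1) * (w - 4) by rewrite mulr_ge0//; lra.
by lra.
Qed.

End rate_function.

Unset Implicit Arguments.
Set Strict Implicit.
Set Printing Implicit Defensive.

Theorem proposition2 (R : realType) (mu : probability (measurableTypeR R) R)
  (mu_sym : symmetric_law mu)
  (mu_var : 'V_mu[(idfun : measurableTypeR R -> R)] = 1%E)
  (A : R) (A_sup : A%:E = (2%:E * ereal_sup (range (psi mu)))%E) (A_gt1 : 1 < A)
  (B : R) (B_ge0 : 0 <= B)
  (B_limp : (2%:E * psi mu x)%E @[x --> +oo] --> B%:E)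
  (B_limn : (2%:E * psi mu x)%E @[x --> -oo] --> B%:E)
  (L_lip : [lipschitz (fine (log_laplace mu (Num.sqrt x)) : R^o)
              | x in [set x : R^o | 0 <= x]])
  (d : measure_display) (T : measurableType d) (P : probability T R)
  (X : forall N, T -> 'M[R]_N)
  (X_wigner : forall N, (0 < N)%N -> wigner P mu (X N))
  (nu : forall N, probability (borel_cV R N) R)
  (nu_unif : forall N, (0 < N)%N -> uniform_on_sphere (nu N)) :
  [/\ lower_semicontinuous (Ibar P X nu),
      (Ibar P X nu x * ((x ^+ 2 / (4 * A))^-1)%:E)%E @[x --> +oo] --> 1%:E
    & good_rate_function (Ibar P X nu)].
Proof.
have [M0 [_ lipM]] := L_lip.
(* A Lipschitz constant that is both positive and strictly above the threshold [M0]. *)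
pose K := Num.max M0 0 + 1.
have K0 : 0 < K by rewrite ltr_wpDl// le_max lexx orbT.
have MK : M0 < K by rewrite ltr_pwDr// le_max lexx.
have ell_lip s t : 0 <= s -> 0 <= t -> `|ell mu s - ell mu t| <= K * `|s - t|.
  by move=> s0 t0; exact: (lipM K MK (s, t) (conj s0 t0)).
have F0 : Fbar P X nu 0 = 0%E := Fbar0 P X nu.
have Fle := Fbar_le mu_sym A_sup X_wigner nu_unif.
have Fge a : 1 < a -> a < A -> exists C : R, forall theta,
    0 <= theta -> ((a * theta ^+ 2 - C)%:E <= Fbar P X nu theta)%E.
  (* The slope [a] is the midpoint of [a] and [A] less [eta = (A - a) / 2]. *)
  move=> a1 aA; have m1 : 1 < (a + A) / 2 by lra.
  have mA : (a + A) / 2 < A by lra.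
  have eta0 : 0 < (A - a) / 2 by lra.
  have [C hC] := @Fbar_ge _ _ mu_sym _ A_sup _ _ _ _ X_wigner _ nu_unif _ K0 ell_lip
    ((a + A) / 2) ((A - a) / 2) m1 mA eta0.
  exists C => theta th0; apply: le_trans (hC theta th0).
  by rewrite lee_fin lerD2r; apply: ler_wpM2r; [exact: sqr_ge0|lra].
have lsc := rate_lower_semicontinuous A_gt1 Fle Fge.
split => //; first exact: rate_equiv A_gt1 F0 Fle Fge.
split => //; first exact: rate_ge0 F0.
exact: rate_compact A_gt1 Fle Fge.
Qed.
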